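(* Let $\mathcal{A}$ be a supersolvable line arrangement in $\mathbb{P}^2=\mathbb{P}^2_{\mathbb{C}}$, let $d=|\mathcal{A}|$ be its number of lines, and let $m=m(\mathcal{A})$ be the maximum multiplicity of a point of intersection of lines of $\mathcal{A}$. Then $\mathcal{A}$ admits unexpected curves if and only if $d>2m$. Moreover, if $d=2m+1$, there is a unique unexpected curve and it has degree $m$.
   Context: Everything is over $\mathbb{C}$. A line arrangement is a finite set $\mathcal{A}$ of distinct lines in the projective plane. $\mathrm{Sing}(\mathcal{A})$ is the set of points where at least two lines of $\mathcal{A}$ meet; for a point $P$, $m(P,\mathcal{A})=|\{\ell\in\mathcal{A} : P\in\ell\}|$, and $m(\mathcal{A})=\max\{m(P,\mathcal{A}) : P\in\mathrm{Sing}(\mathcal{A})\}$. A line arrangement $\mathcal{A}$ is supersolvable if it has a modular point, i.e. a point $P$ such that for every $Q\in\mathrm{Sing}(\mathcal{A})$ (with $Q\neq P$) the line joining $P$ and $Q$ belongs to $\mathcal{A}$. Duality: the line $\{p_0y_0+p_1y_1+p_2y_2=0\}$ is dual to the point $(p_0:p_1:p_2)$; the dual configuration of $\mathcal{A}$ is the set $Z$ of points dual to the lines of $\mathcal{A}$. Unexpected curves: let $S=\mathbb{C}[x_0,x_1,x_2]$ with the standard grading; for a homogeneous ideal $I$ write $[I]_i$ for its degree $i$ part. For a finite set $Z$ of reduced points in $\mathbb{P}^2$ with homogeneous ideal $I(Z)$, a point $Q$ with ideal $I(Q)$ and an integer $j$, put $I(Z+jQ)=I(Z)\cap I(Q)^j$.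 The set $Z$ admits unexpected curves of degree $j+1$ if for a general point $Q\in\mathbb{P}^2$ one has $\dim_{\mathbb{C}}[I(Z+jQ)]_{j+1}>\max\{\dim_{\mathbb{C}}[I(Z)]_{j+1}-\binom{j+1}{2},0\}$; in this case the unexpected curves of degree $j+1$ are the curves defined by nonzero elements of $[I(Z+jQ)]_{j+1}$, for $Q$ general. $Z$ admits unexpected curves if it does so in some degree. ''There is a unique unexpected curve, of degree $m$'' means that $Z$ admits unexpected curves in degree $m$ only, and for general $Q$ there is exactly one curve of degree $m$ in that system, i.e. $\dim_{\mathbb{C}}[I(Z+(m-1)Q)]_{m}=1$. A line arrangement is said to admit unexpected curves if its dual configuration of points does. *)

(* Defs.v *)
From HB Require Import structures.
From mathcomp Require Import all_boot all_order all_algebra finmap.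
From mathcomp Require Import mpoly.
From mathcomp Require Import boolp classical_sets reals complex.

Set Implicit Arguments.
Unset Strict Implicit.
Unset Printing Implicit Defensive.

Import Order.TTheory GRing.Theory Num.Theory.

Local Open Scope ring_scope.
Local Open Scope classical_set_scope.

Section ProjectivePlane.
Variable F : fieldType.

(* Points and lines of P^2 are the linear subspaces of F^3 of dimension 1
   and 2, so that equality is equality in P^2 and incidence is inclusion. *)
Record point := Point
  { point_space :> {vspace 'rV[F]_3}; point_dim : \dim point_space == 1%N }.
HB.instance Definition _ := [isSub for point_space].
HB.instance Definition _ := [Choice of point by <:].

Record line := Line
  { line_space :> {vspace 'rV[F]_3}; line_dim : \dim line_space == 2%N }.
HB.instance Definition _ := [isSub for line_space].
HB.instance Definition _ := [Choice of line by <:].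

Definition incident (P : point) (l : line) : bool := (P <= l)%VS.

Definition mult (A : {fset line}) (P : point) : nat :=
  #|` [fset l in A | incident P l]%fset|.

Definition Sing (A : {fset line}) : set point := [set P | (2 <= mult A P)%N].

(* m = m(A), the maximum of m(P, A) over Sing(A); no m satisfies this when
   Sing(A) is empty, in which case m(A) is not defined. *)
Definition is_max_mult (A : {fset line}) (m : nat) : Prop :=
  (exists2 P, Sing A P & mult A P = m) /\
  (forall P, Sing A P -> (mult A P <= m)%N).

Definition modular_point (A : {fset line}) (P : point) : Prop :=
  forall Q, Sing A Q -> Q != P ->
    exists2 l, l \in A & (l : {vspace _}) = (P + Q)%VS.

Definition supersolvable (A : {fset line}) : Prop :=
  exists P, modular_point A P.

(* The orthogonal for the form \sum_i v_i y_i; see memv_orth. *)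
Definition orth (U : {vspace 'rV[F]_3}) : {vspace 'rV[F]_3} :=
  lker (linfun (mulmxr (\matrix_(i < \dim U) (vbasis U)`_i)^T)).

Lemma memv_orth (U : {vspace 'rV[F]_3}) (y : 'rV[F]_3) :
  (y \in orth U) <-> (forall v, v \in U -> \sum_i v 0 i * y 0 i = 0).
Proof.
have dotC (v : 'rV[F]_3) : \sum_i v 0 i * y 0 i = (y *m v^T) 0 0.
  by rewrite mxE; apply: eq_bigr => i _; rewrite mxE mulrC.
rewrite memv_ker lfunE /=; split=> [/eqP yU v vU | yU].
  rewrite dotC (coord_vbasis vU) linear_sum mulmx_sumr summxE big1 // => i _.
  rewrite linearZ /= -scalemxAr !mxE.
  suff -> : \sum_j y 0 j * ((vbasis U)`_i)^T j 0 = 0 by rewrite mulr0.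
  have := congr1 (fun M : 'rV_(\dim U) => M 0 i) yU; rewrite !mxE => yUi.
  by rewrite -[RHS]yUi; apply: eq_bigr => j _; rewrite !mxE.
apply/eqP/rowP=> i; rewrite !mxE.
have bU : (vbasis U)`_i \in U by apply: vbasis_mem; rewrite mem_nth ?size_tuple.
rewrite -[RHS](yU _ bU); apply: eq_bigr => j _.
by rewrite !mxE mulrC.
Qed.

Lemma dim_rV n : \dim {: 'rV[F]_n} = n.
Proof. by rewrite dimvf dim_matrix; apply: mul1n. Qed.

Lemma dim_orth (U : {vspace 'rV[F]_3}) : \dim (orth U) = (3 - \dim U)%N.
Proof.
set B := \matrix_(i < \dim U) (vbasis U)`_i.
have freeB : row_free B.
  apply: inj_row_free => w wB.
  have /freeP frB := basis_free (vbasisP U).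
  apply/rowP=> i; rewrite mxE; apply: (frB (w 0)) => //.
  rewrite -[RHS]wB mulmx_sum_row; apply: eq_bigr => j _.
  by rewrite rowK.
have /row_freeP[C BC] := freeB.
have lim : limg (linfun (mulmxr B^T : 'rV[F]_3 -> 'rV[F]_(\dim U))) = fullv.
  apply/eqP; rewrite eqEsubv subvf; apply/subvP=> w _; apply/memv_imgP.
  exists (w *m C^T); rewrite ?memvf // lfunE /= -mulmxA -trmx_mul BC.
  by rewrite trmx1 mulmx1.
have := limg_ker_dim (linfun (mulmxr B^T : 'rV[F]_3 -> 'rV[F]_(\dim U))) fullv.
rewrite lim capfv !dim_rV => dimE.
by rewrite -(addnK (\dim U) (\dim (orth U))) dimE.
Qed.

Lemma orthK (U : {vspace 'rV[F]_3}) : orth (orth U) = U.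
Proof.
apply/eqP; rewrite eq_sym eqEdim !dim_orth subKn; last first.
  by rewrite (leq_trans (dimvS (subvf U))) // dim_rV.
rewrite leqnn andbT; apply/subvP=> u uU; apply/memv_orth => v /memv_orth vU.
by rewrite -[RHS](vU _ uU); apply: eq_bigr => i _; rewrite mulrC.
Qed.

Lemma dual_point_subproof (l : line) : \dim (orth l) == 1%N.
Proof. by rewrite dim_orth (eqP (line_dim l)). Qed.

Definition dual_point (l : line) : point := Point (dual_point_subproof l).

(* [l] is the line p_0 y_0 + p_1 y_1 + p_2 y_2 = 0 with p its dual point. *)
Lemma dual_pointP (l : line) (y : 'rV[F]_3) :
  (y \in line_space l) <->
  (forall p, p \in point_space (dual_point l) -> \sum_i p 0 i * y 0 i = 0).
Proof. by rewrite -memv_orth /= orthK. Qed.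

Definition dual_config (A : {fset line}) : {fset point} :=
  [fset dual_point l | l in A]%fset.

(* For every f, not necessarily homogeneous: vanishing on the line of F^3 that
   represents P.  Over an infinite field such f are those all of whose
   homogeneous components vanish at P. *)
Definition vanishes_at (f : {mpoly F[3]}) (P : point) : Prop :=
  forall v, v \in point_space P -> f.@[v 0] = 0.

Definition vanishing_ideal (Z : {fset point}) : set {mpoly F[3]} :=
  [set f | forall P, P \in Z -> vanishes_at f P].

Definition ideal_mul (I J : set {mpoly F[3]}) : set {mpoly F[3]} :=
  [set f | exists2 s : seq ({mpoly F[3]} * {mpoly F[3]}),
     (forall gh, gh \in s -> I gh.1 /\ J gh.2)
     & f = \sum_(gh <- s) gh.1 * gh.2].

Definition ideal_exp (I : set {mpoly F[3]}) (j : nat) : set {mpoly F[3]} :=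
  iter j (ideal_mul I) setT.

(* I(Z + jQ) *)
Definition fat_ideal (Z : {fset point}) (j : nat) (Q : point) :
    set {mpoly F[3]} :=
  vanishing_ideal Z `&` ideal_exp (vanishing_ideal [fset Q]%fset) j.

(* The degree i part of I.  The default value of xget is never used for a
   linear subspace I; see graded_partP. *)
Definition graded_part (I : set {mpoly F[3]}) (i : nat) :
    {vspace dhomog 3 F i} :=
  xget 0%VS [set U : {vspace dhomog 3 F i} |
    forall f : dhomog 3 F i, f \in U <-> I (mpoly_of_dhomog f)].

Definition linear_subspace (I : set {mpoly F[3]}) : Prop :=
  I 0 /\ forall a f g, I f -> I g -> I (a *: f + g).

Lemma graded_partP (I : set {mpoly F[3]}) (i : nat) : linear_subspace I ->
  forall f : dhomog 3 F i, f \in graded_part I i <-> I (mpoly_of_dhomog f).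
Proof.
move=> [I0 IL]; rewrite /graded_part; case: xgetP => [U _ //|noU] f.
exfalso.
pose inI (U : {vspace dhomog 3 F i}) :=
  forall g, g \in U -> I (mpoly_of_dhomog g).
pose p := fun d => `[< exists2 U, inI U & \dim U = d >].
have ex_p : exists d, p d.
  exists 0%N; apply/asboolP; exists 0%VS; last by rewrite dimv0.
  by move=> g; rewrite memv0 => /eqP ->.
have p_ub d : p d -> (d <= \dim {: dhomog 3 F i})%N.
  by move=> /asboolP[U _ <-]; apply: dimvS (subvf U).
case: (ex_maxnP ex_p p_ub) => d /asboolP[U UI dU] max_d.
apply: (noU U) => g; split=> [/UI //|Ig].
have /max_d : p (\dim (<[g]> + U)%VS).
  apply/asboolP; exists (<[g]> + U)%VS => // h /memv_addP[_ /vlineP[a ->]].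
  by move=> [u uU ->]; apply: (IL a _ _ Ig (UI _ uU)).
rewrite -dU => le_dim.
have : U == (<[g]> + U)%VS by rewrite eqEdim addvSr.
by move/eqP ->; apply: (subvP (addvSl _ _)); apply: memv_line.
Qed.

Lemma vanishing_ideal_subspace Z : linear_subspace (vanishing_ideal Z).
Proof.
split=> [P _ v _ | a f g If Ig P PZ v vP]; first by rewrite meval0.
by rewrite mevalD mevalZ (If P PZ v vP) (Ig P PZ v vP) mulr0 addr0.
Qed.

Lemma ideal_exp_subspace I j :
  linear_subspace I -> linear_subspace (ideal_exp I j).
Proof.
move=> [I0 IL]; elim: j => [|j [_ IHL]] //=; split.
  by exists [::]; rewrite ?big_nil.
move=> a _ _ [s sIJ ->] [t tIJ ->].
exists ([seq (a *: gh.1, gh.2) | gh <- s] ++ t); last first.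
  rewrite big_cat big_map /= scaler_sumr; congr (_ + _).
  by apply: eq_bigr => gh _; rewrite scalerAl.
move=> gh; rewrite mem_cat => /orP[/mapP[gh' /sIJ[Ig Jh] ->]|/tIJ //] /=.
by split=> //; rewrite -[_ *: _]addr0; apply: IL.
Qed.

Lemma fat_ideal_subspace Z j Q : linear_subspace (fat_ideal Z j Q).
Proof.
have [Z0 ZL] := vanishing_ideal_subspace Z.
have [Q0 QL] := ideal_exp_subspace j (vanishing_ideal_subspace [fset Q]%fset).
by split=> // a f g [Zf Qf] [Zg Qg]; split; [apply: ZL | apply: QL].
Qed.

Definition zariski_closed (V : set point) : Prop :=
  exists S : set {mpoly F[3]},
    (forall f, S f -> exists d, f \is d.-homog) /\
    V = [set P | forall f, S f -> vanishes_at f P].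

(* "H holds for a general point": on a nonempty Zariski-open subset. *)
Definition general (H : set point) : Prop :=
  exists V, [/\ zariski_closed V, V <> setT & ~` V `<=` H].

(* The truncated subtraction is max {dim [I(Z)]_(j+1) - binom(j+1,2), 0}. *)
Definition unexpected_in_degree (Z : {fset point}) (t : nat) : Prop :=
  exists2 j, t = j.+1 &
    general [set Q |
      (\dim (graded_part (vanishing_ideal Z) j.+1) - 'C(j.+1, 2)
       < \dim (graded_part (fat_ideal Z j Q) j.+1))%N].

Definition admits_unexpected (Z : {fset point}) : Prop :=
  exists t, unexpected_in_degree Z t.

Definition unique_unexpected_curve (Z : {fset point}) (m : nat) : Prop :=
  (forall t, unexpected_in_degree Z t <-> t = m) /\
  general [set Q | \dim (graded_part (fat_ideal Z m.-1 Q) m) = 1%N].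

Definition arrangement_admits_unexpected (A : {fset line}) : Prop :=
  admits_unexpected (dual_config A).

End ProjectivePlane.

(* Main.v *)
From HB Require Import structures.
Require Import Defs.
From mathcomp Require Import all_boot all_order all_algebra finmap.
From mathcomp Require Import mpoly ring zify.
From mathcomp Require Import boolp reals complex.

(** Let p be a point of multiplicity m of the arrangement, and d the number of
    lines.  Dually, p is a line that contains m of the d points of Z.

    A curve of degree j + 1 with a point of multiplicity j at a general point Q
    has an equation s G + P = 0, where s is an equation of the line p and G, P are
    binary forms of degrees j and j + 1 on the pencil of lines through Q.  If it
    passes through Z, then P vanishes on the m points of Z on p, and if P = 0 then
    G vanishes on the d - m others.  So the system has dimension at most
    max(0, j + 2 - m) + max(0, j + 1 - (d - m)) (fat_curve_eq0, fat_dim_le).  The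
    forms of degree j + 1 vanishing on Z have codimension at most
    min(m, j + 2) + (d - m) (vanishing_dim_ge), and comparing the two bounds shows
    that an unexpected curve can exist only if m - 2 < j < d - m - 1.  There is
    no such j if d <= 2m, and j = m - 1 is the only one if d = 2m + 1
    (not_unexpected).

    For the converse one needs, when d > 2m, a curve of degree m with
    multiplicity m - 1 at Q, whereas none is expected.  None is expected because Z
    imposes at least 2m + 1 conditions on forms of degree m: no line contains more
    than m points of Z, and unions of m lines separate m points of Z on p and
    m + 1 points of Z off p (separating_curve, dim_vanishing_le).  A curve
    exists because the point p may be taken modular: in a supersolvable
    arrangement every point of maximal multiplicity is (max_mult_modular).
    Dually, the line through two points of Z off p meets p in a point of Z.
    Finding the curve is a problem of interpolation by binary forms of degree
    m - 1 at d - m > m - 1 points.  It is overdetermined, but it comes from a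
    problem of interpolation along lines of a plane, in which the corrections of
    Newton's method are polynomial thanks to the modularity of p, and vanish for
    reasons of degree once m lines have been treated (interpolation_step_dvd,
    supersolvable_interpolation, supersolvable_curve). *)

Set Implicit Arguments.
Unset Strict Implicit.
Unset Printing Implicit Defensive.

Import Order.TTheory GRing.Theory Num.Theory.

Local Open Scope ring_scope.

(** * Nonvanishing of polynomials over an infinite field *)

Lemma fresh_seq (F : numFieldType) (s : seq F) n :
  exists xs, [/\ size xs = n, uniq xs & forall x, x \in xs -> x \notin s].
Proof.
elim: n => [|n [xs [sz_xs uxs xsP]]]; first by exists [::].
pose nats := [seq i%:R : F | i <- iota 0 (size (s ++ xs)).+1].
have [/allP sub|/allPn[x _ xP]] := boolP (all (mem (s ++ xs)) nats).
  have /uniq_leq_size/(_ sub) : uniq nats.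
    by rewrite map_inj_uniq ?iota_uniq //; exact: mulrIn (oner_neq0 F).
  by rewrite size_map size_iota ltnn.
move: xP; rewrite inE mem_cat negb_or => /andP[xs' xxs].
exists (x :: xs); rewrite /= sz_xs xxs uxs; split=> // y.
by rewrite inE => /orP[/eqP ->//|/xsP].
Qed.

Lemma nonroot_exists (F : numFieldType) (p : {poly F}) :
  p != 0 -> exists x, p.[x] != 0.
Proof.
move=> p0; have [xs [sz uxs _]] := fresh_seq (F := F) [::] (size p).
have [rts|/allPn[x _ px]] := boolP (all (root p) xs); last by exists x.
by have := max_poly_roots p0 rts uxs; rewrite sz ltnn.
Qed.

(** The coefficient of p at its leading monomial m0 reappears in muni p, as
    a coefficient of the coefficient at the exponent of the last variable. *)
Lemma muni_neq0 n (F : fieldType) (p : {mpoly F[n.+1]}) :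
  p != 0 -> muni p != 0.
Proof.
move=> /mlead_supp; set m0 := mlead p => m0p; apply/eqP => mp0.
pose low m := [multinom (m (widen_ord (leqnSn n) i)) | i < n].
have : ((muni p)`_(m0 ord_max))@_(low m0) = p@_m0.
  rewrite muniE coef_sum raddf_sum /= (bigD1_seq m0) ?msupp_uniq //=.
  rewrite coefZ coefXn eqxx mulr1 mcoeffZ mcoeffX eqxx mulr1.
  rewrite big1 ?addr0 // => m mm0; rewrite coefZ coefXn.
  case: eqP => [e|_]; last by rewrite mulr0 mcoeff0.
  rewrite mulr1 mcoeffZ mcoeffX; case: eqP => [e'|_]; last by rewrite mulr0.
  case/eqP: mm0; apply/mnmP => i.
  case: (unliftP ord_max i) => [j ->|-> //].
  have := congr1 (fun m : 'X_{1.. n} => m j) e'; rewrite !mnmE.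
  have -> // : widen_ord (leqnSn n) j = lift ord_max j.
  by apply: val_inj => /=; rewrite /bump leqNgt ltn_ord.
rewrite mp0 coef0 mcoeff0 => /esym/eqP; apply/negP.
by rewrite -mcoeff_msupp.
Qed.

Lemma meval_muni n (F : fieldType) (p : {mpoly F[n.+1]}) (v : 'I_n.+1 -> F) :
  p.@[v] =
  (map_poly (meval (fun i => v (widen_ord (leqnSn n) i))) (muni p)).[v ord_max].
Proof.
rewrite muniE rmorph_sum /= horner_sum mevalE; apply: eq_bigr => m _.
rewrite map_polyZ map_polyXn hornerZ hornerXn /= mevalZ mevalX -mulrA.
rewrite big_ord_recr /=; congr (_ * (_ * _)).
by apply: eq_bigr => i _; rewrite mnmE.
Qed.

(** Applied to a product of polynomials, this is the irreducibility of affine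
    space over an infinite field: finitely many nonempty open sets meet. *)
Lemma mpoly_nonzero_point n (F : numFieldType) (p : {mpoly F[n]}) :
  p != 0 -> exists v : 'rV[F]_n, p.@[v 0] != 0.
Proof.
move=> p0; suff [v pv] : exists v, p.@[v] != 0.
  by exists (\row_i v i); rewrite (meval_eq _ (_ : _ =1 v)) // => i; rewrite mxE.
elim: n p p0 => [|n IH] p p0.
  exists (fun=> 0); apply: contraNneq p0 => p0; apply/eqP/mpolyP => m.
  have m0 (m' : 'X_{1.. 0}) : m' = 0%MM by apply/mnmP => -[].
  have pE : p = p@_0 *: 'X_[0].
    by apply/mpolyP => m'; rewrite (m0 m') mcoeffZ mcoeffX eqxx mulr1.
  move: p0; rewrite {1}pE mevalZ mpolyX0 meval1 mulr1 => p0.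
  by rewrite (m0 m) p0 mcoeff0.
have := muni_neq0 p0; rewrite -lead_coef_eq0 => /IH[v].
set c := lead_coef _ => cv.
have : map_poly (meval v) (muni p) != 0.
  apply: contraNneq cv => e.
  by rewrite /c lead_coefE -coef_map /= e coef0.
move=> /nonroot_exists[x px].
exists (fun i => if unlift ord_max i is Some j then v j else x).
rewrite meval_muni unlift_none; congr (_ != 0): px; congr horner.
apply: eq_map_poly => q; apply: meval_eq => i.
have -> : widen_ord (leqnSn n) i = lift ord_max i.
  by apply: val_inj => /=; rewrite /bump leqNgt ltn_ord.
by rewrite liftK.
Qed.


(** * Vectors of the dual plane *)

Section Vectors.
Variable F : fieldType.
Implicit Types (u v w x : 'rV[F]_3) (a b : F).

Definition dot u v : F := \sum_i u 0 i * v 0 i.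

(** Indices are added in the ring 'I_3, so that i + 1 and i + 2 are the two other
    coordinates in cyclic order. *)
Definition cross u v : 'rV[F]_3 :=
  \row_(i < 3) (u 0 (i + 1) * v 0 (i + 2) - u 0 (i + 2) * v 0 (i + 1)).

Definition det3 u v w : F := dot (cross u v) w.

(** By duality u may be read as a line and v as a point of it, or v as a line
    and u as a point of it; both readings are used below. *)
Definition on_line u : pred 'rV[F]_3 := fun v => dot u v == 0.

Lemma dotE u v : dot u v = u 0 0 * v 0 0 + u 0 1 * v 0 1 + u 0 2 * v 0 2.
Proof.
rewrite /dot !big_ord_recl big_ord0 addr0 addrA.
by congr (_ + u 0 _ * v 0 _ + u 0 _ * v 0 _); apply: val_inj.
Qed.

Lemma crossE u v :
  [/\ cross u v 0 0 = u 0 1 * v 0 2 - u 0 2 * v 0 1,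
      cross u v 0 1 = u 0 2 * v 0 0 - u 0 0 * v 0 2 &
      cross u v 0 2 = u 0 0 * v 0 1 - u 0 1 * v 0 0].
Proof.
rewrite !mxE; split;
  congr (u 0 _ * v 0 _ - u 0 _ * v 0 _); by apply: val_inj.
Qed.

Lemma row3P u v :
  u 0 0 = v 0 0 -> u 0 1 = v 0 1 -> u 0 2 = v 0 2 -> u = v.
Proof.
move=> e0 e1 e2; apply/rowP => -[[|[|[|//]]] lti].
- by rewrite (_ : Ordinal lti = 0) //; apply: val_inj.
- by rewrite (_ : Ordinal lti = 1) //; apply: val_inj.
- by rewrite (_ : Ordinal lti = 2) //; apply: val_inj.
Qed.

Lemma dotC u v : dot u v = dot v u.
Proof. by apply: eq_bigr => i _; rewrite mulrC. Qed.

Lemma dotDr u v w : dot u (v + w) = dot u v + dot u w.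
Proof. by rewrite !dotE !mxE; ring. Qed.

Lemma dotZr a u v : dot u (a *: v) = a * dot u v.
Proof. by rewrite !dotE !mxE; ring. Qed.

Lemma dot0r u : dot u 0 = 0.
Proof. by rewrite dotE !mxE !mulr0 !addr0. Qed.

Lemma det3C u v w : det3 u v w = det3 v w u.
Proof.
rewrite /det3 !dotE.
by have [-> -> ->] := crossE u v; have [-> -> ->] := crossE v w; ring.
Qed.

Lemma det3N u v w : det3 v u w = - det3 u v w.
Proof.
rewrite /det3 !dotE.
by have [-> -> ->] := crossE u v; have [-> -> ->] := crossE v u; ring.
Qed.

Lemma det3_id u w : det3 u u w = 0.
Proof. by rewrite /det3 !dotE; have [-> -> ->] := crossE u u; ring. Qed.

Lemma det3Dr u v w x : det3 u v (w + x) = det3 u v w + det3 u v x.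
Proof. exact: dotDr. Qed.

Lemma det3Zr a u v w : det3 u v (a *: w) = a * det3 u v w.
Proof. exact: dotZr. Qed.

Lemma cramer3 u v w x : det3 u v w *: x =
  det3 x v w *: u + det3 u x w *: v + det3 u v x *: w.
Proof.
rewrite /det3 !dotE.
have [-> -> ->] := crossE u v; have [-> -> ->] := crossE x v.
by have [-> -> ->] := crossE u x; apply: row3P; rewrite !mxE; ring.
Qed.

Lemma double_cross u v w : cross u (cross v w) = dot u w *: v - dot u v *: w.
Proof.
have [f0 f1 f2] := crossE v w; move: (cross v w) f0 f1 f2 => c f0 f1 f2.
have [e0 e1 e2] := crossE u c.
by apply: row3P; rewrite ?e0 ?e1 ?e2 ?f0 ?f1 ?f2 !dotE !mxE; ring.
Qed.

Lemma dot_crossl u v : dot u (cross u v) = 0.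
Proof. by rewrite dotC -/(det3 u v u) -det3C det3_id. Qed.

Lemma dot_crossr u v : dot v (cross u v) = 0.
Proof. by rewrite dotC -/(det3 u v v) det3C det3_id. Qed.

Lemma crossN u v : cross v u = - cross u v.
Proof.
by apply/rowP => i; rewrite !mxE; ring.
Qed.

Lemma vec_neq0 u : u != 0 -> [|| u 0 0 != 0, u 0 1 != 0 | u 0 2 != 0].
Proof.
apply: contraR; rewrite !negb_or !negbK => /and3P[/eqP u0 /eqP u1 /eqP u2].
by apply/eqP; apply: row3P; rewrite mxE.
Qed.

Lemma dot_nondeg u : u != 0 -> exists v, dot u v != 0.
Proof.
have du i : dot u (delta_mx 0 i) = u 0 i.
  rewrite /dot (bigD1 i) //= mxE !eqxx mulr1 big1 ?addr0 // => k ki.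
  by rewrite mxE (negPf ki) andbF mulr0.
by case/vec_neq0/or3P => ui; [exists (delta_mx 0 0)|exists (delta_mx 0 1)
  |exists (delta_mx 0 2)]; rewrite du.
Qed.

Lemma coplanar_span u v w : cross u v != 0 -> det3 u v w = 0 ->
  exists a b, w = a *: u + b *: v.
Proof.
move=> /dot_nondeg[x]; rewrite -/(det3 u v x) => d0 uvw0.
exists (det3 w v x / det3 u v x), (det3 u w x / det3 u v x).
apply: (scalerI d0); rewrite cramer3 uvw0 scale0r addr0 scalerDr !scalerA.
by rewrite ![det3 u v x * _]mulrC !divfK.
Qed.

Lemma cross_eq0_colinear u v : u != 0 -> cross u v = 0 -> exists a, v = a *: u.
Proof.
move=> /dot_nondeg[x ux] uv0; exists (dot x v / dot u x).
apply: (scalerI ux); rewrite scalerA mulrC divfK // (dotC u).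
have := double_cross x u v; rewrite uv0.
have -> : cross x 0 = 0 by apply/rowP => i; rewrite !mxE !mulr0 subrr.
by move/esym/eqP; rewrite subr_eq0 => /eqP ->.
Qed.

Definition pairwise_indep (zs : seq 'rV[F]_3) :=
  {in zs &, forall z z', z != z' -> cross z z' != 0}.

Definition linform u : {mpoly F[3]} := \sum_i u 0 i *: 'X_i.

Lemma meval_linform u v : (linform u).@[v 0] = dot u v.
Proof.
by rewrite /linform raddf_sum; apply: eq_bigr => i _; rewrite [LHS]mevalZ mevalXU.
Qed.

Lemma linform_homog u : linform u \is 1.-homog.
Proof.
by apply: rpred_sum => i _; apply: rpredZ; rewrite dhomogX; apply/eqP/mdeg1.
Qed.

Lemma linform_eq0 u : (linform u == 0) = (u == 0).
Proof.
apply/eqP/eqP => [u0|->]; last by rewrite /linform big1 // => i _; rewrite mxE scale0r.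
apply: contra_eq (u0) => /dot_nondeg[v]; apply: contraNneq => l0.
by rewrite -meval_linform l0 meval0.
Qed.

End Vectors.

(** Simultaneously off a curve and off finitely many lines. *)
Lemma generic_vector (F : numFieldType) (f : {mpoly F[3]}) (s : seq 'rV[F]_3) :
  f != 0 -> 0 \notin s ->
  exists2 v : 'rV_3, f.@[v 0] != 0 & forall u, u \in s -> dot u v != 0.
Proof.
move=> f0 s0.
have : f * \prod_(u <- s) linform u != 0.
  rewrite mulf_neq0 // prodf_seq_neq0; apply/allP => u us.
  by rewrite linform_eq0; apply: contraNneq s0 => <-.
move=> /mpoly_nonzero_point[v]; rewrite mevalM mulf_eq0 negb_or => /andP[fv].
rewrite rmorph_prod /= prodf_seq_neq0 => /allP sv.
by exists v => // u /sv; rewrite meval_linform.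
Qed.

(** * Forms on lines and counting of conditions *)

Section LineRestriction.
Variable F : fieldType.
Implicit Types (u v w : 'rV[F]_3) (f g : {mpoly F[3]}).

Definition line_restr u v f : {poly F} :=
  mmap polyC (fun i => (u 0 i)%:P + v 0 i *: 'X) f.

Lemma horner_line_restr u v f t :
  (line_restr u v f).[t] = f.@[(u + t *: v) 0].
Proof.
rewrite /line_restr /mmap horner_sum mevalE; apply: eq_bigr => m _.
rewrite hornerCM /mmap1 horner_prod; congr (_ * _).
by apply: eq_bigr => i _; rewrite !hornerE !mxE mulrC.
Qed.

Lemma line_restrM u v f g :
  line_restr u v (f * g) = line_restr u v f * line_restr u v g.
Proof. exact: rmorphM. Qed.

Lemma top_coefM (p q : {poly F}) d e :
  (size p <= d.+1)%N -> (size q <= e.+1)%N ->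
  (size (p * q)%R <= (d + e).+1)%N /\ (p * q)`_(d + e) = p`_d * q`_e.
Proof.
move=> sp sq; split.
  apply: leq_trans (size_polyMleq p q) _; have := leq_add sp sq.
  by case: (size p + size q)%N => //= k; rewrite addSn addnS ltnS.
have ltd : (d < (d + e).+1)%N by rewrite ltnS leq_addr.
rewrite coefM (bigD1 (Ordinal ltd)) //= addKn big1 ?addr0 // => i id.
have [lt_di|] := ltnP d i; first by rewrite nth_default ?mul0r // (leq_trans sp).
rewrite leq_eqVlt -[(_ == d)%N]/(i == Ordinal ltd) (negPf id) /= => lt_id.
by rewrite mulrC nth_default ?mul0r // (leq_trans sq) // ltn_subRL ltn_add2r.
Qed.

(** The direction v is the point at infinity of the line t |-> u + t v: there a
    form takes the value of the top coefficient of its restriction. *)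
Lemma line_restr_homog u v f d : f \is d.-homog ->
  (size (line_restr u v f) <= d.+1)%N /\ (line_restr u v f)`_d = f.@[v 0].
Proof.
move=> /dhomogP fd; rewrite /line_restr /mmap mevalE coef_sum.
have mono (m : 'X_{1..3}) : (size (\prod_(i < 3) ((u 0 i)%:P + v 0 i *: 'X) ^+ m i)%R
                <= (mdeg m).+1)%N /\
    (\prod_(i < 3) ((u 0 i)%:P + v 0 i *: 'X) ^+ m i)`_(mdeg m)
      = \prod_(i < 3) v 0 i ^+ m i.
  rewrite mdegE; elim/big_rec3: _ => [|i c e p _ [sp cp]].
    by rewrite size_poly1 coef1.
  rewrite -cp; set l := _ + _.
  have [sl cl] : (size (l ^+ m i)%R <= (m i).+1)%N /\ (l ^+ m i)`_(m i) = v 0 i ^+ m i.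
    have sl : (size l <= 2)%N.
      rewrite (leq_trans (size_polyD _ _)) // geq_max.
      rewrite (leq_trans (size_polyC_leq1 _)) // (leq_trans (size_scale_leq _ _)) //.
      by rewrite size_polyX.
    have cl : l`_1 = v 0 i by rewrite coefD coefC coefZ coefX /= add0r mulr1.
    elim: (m i : nat) => [|k [sk ck]]; first by rewrite !expr0 size_poly1 coef1.
    by rewrite !exprS; have := top_coefM sl sk; rewrite cl ck add1n.
  by have [] := top_coefM sl sp; rewrite cl.
split.
  rewrite big_seq; apply: (big_ind (fun p : {poly F} => size p <= d.+1)%N).
  - by rewrite size_poly0.
  - move=> p q sp sq; apply: leq_trans (size_polyD _ _) _.
    by rewrite geq_max sp.
  move=> m /fd <-; rewrite mul_polyC (leq_trans (size_scale_leq _ _)) //.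
  by have [] := mono m.
rewrite big_seq [RHS]big_seq; apply: eq_bigr => m /fd <-.
by rewrite coefCM; have [_ <-] := mono m.
Qed.

Lemma meval_homogZ f d a v : f \is d.-homog ->
  f.@[(a *: v) 0] = a ^+ d * f.@[v 0].
Proof.
move=> /dhomogP fd; rewrite !mevalE mulr_sumr big_seq [RHS]big_seq.
apply: eq_bigr => m mf; have dE : d = (\sum_i m i)%N by rewrite -mdegE -(fd m mf).
rewrite mulrCA dE -prodrXr -big_split /=.
by congr (_ * _); apply: eq_bigr => i _; rewrite mxE exprMn.
Qed.

(** A product of j polynomials vanishing at q restricts, on any line through q,
    to a multiple of t^j. *)
Lemma line_restr_ideal_exp (Q : point F) q v j f :
  q \in point_space Q -> ideal_exp (vanishing_ideal [fset Q]%fset) j f ->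
  'X^j %| line_restr q v f.
Proof.
move=> qQ; elim: j f => [|j IH] f; first by rewrite expr0 dvd1p.
move=> [s sP ->]; rewrite [line_restr _ _ _]rmorph_sum big_seq.
apply: (big_ind (fun p => 'X^(j.+1) %| p)); [exact: dvdp0|exact: dvdp_add|].
move=> gh /sP[Ig Jh]; rewrite [X in _ %| X]line_restrM exprS dvdp_mul ?IH //.
rewrite -['X]subr0 -polyC0 dvdp_XsubCl /root horner_line_restr scale0r addr0.
by apply/eqP/(Ig Q) => //; rewrite inE.
Qed.

(** On a line through Q, a form of degree j + 1 with a point of multiplicity j at
    Q is t^j times an affine function of t.  Hence such a form is affine in the
    coordinate along q: it is A(v) a + f(v), with A(v) = f(q + v) - f(v). *)
Lemma fat_meval (Q : point F) q v j f a :
  f \is j.+1.-homog -> q \in point_space Q ->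
  ideal_exp (vanishing_ideal [fset Q]%fset) j f ->
  f.@[(a *: q + v) 0] = a * (f.@[(q + v) 0] - f.@[v 0]) + f.@[v 0].
Proof.
move=> fj qQ /(line_restr_ideal_exp v qQ)/dvdpP[r rE].
have [sr cr] := line_restr_homog q v fj.
have [r0 [r1 {}rE]] : exists r0 r1, line_restr q v f = (r0%:P + r1 *: 'X) * 'X^j.
  have sr2 : (size r <= 2)%N.
    have [->|r0] := eqVneq r 0; first by rewrite size_poly0.
    by move: sr; rewrite rE size_Mmonic ?monicXn // size_polyXn addnS /= -[j.+2]/(2 + j)%N leq_add2r.
  exists r`_0, r`_1; rewrite rE; congr (_ * _); apply/polyP => i.
  rewrite coefD coefC coefZ coefX; case: i => [|[|i]] /=.
  - by rewrite mulr0 addr0.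
  - by rewrite add0r mulr1.
  by rewrite mulr0 addr0 nth_default // (leq_trans sr2).
have r1E : r1 = f.@[v 0].
  by rewrite -cr rE coefMXn ltnNge leqnSn /= subSnn coefD coefC coefZ coefX /= add0r mulr1.
have ev t : f.@[(q + t *: v) 0] = (r0 + r1 * t) * t ^+ j.
  by rewrite -horner_line_restr rE !hornerE.
have ev1 : f.@[(q + v) 0] = r0 + r1 by rewrite -[v]scale1r ev expr1n !mulr1.
(* For a != 0, homogeneity moves the point to q + a^-1 v. *)
have [->|a0] := eqVneq a 0; first by rewrite scale0r add0r mul0r add0r.
have -> : a *: q + v = a *: (q + a^-1 *: v) by rewrite scalerDr scalerA divff ?scale1r.
rewrite (meval_homogZ _ _ fj) ev ev1 -r1E exprS.
have -> : a * a ^+ j * ((r0 + r1 / a) * a^-1 ^+ j) = a * (r0 + r1 / a) * (a * a^-1) ^+ j.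
  by rewrite exprMn; ring.
by rewrite divff // expr1n mulr1 addrK mulrDr mulrCA divff // mulr1.
Qed.

End LineRestriction.

Section EvaluationCount.
Variables (F : fieldType) (d : nat).
Implicit Types (f : dhomog 3 F d) (V W : {vspace dhomog 3 F d})
  (s : seq 'rV[F]_3).

Definition evals (s : seq 'rV[F]_3) f : 'rV[F]_(size s) :=
  \row_i (mpoly_of_dhomog f).@[s`_i 0].

Lemma evals_linear s : linear (evals s).
Proof. by move=> a f g; apply/rowP => i; rewrite !mxE /= mevalD mevalZ. Qed.

HB.instance Definition _ s := GRing.isLinear.Build F _ _ _ (evals s) (evals_linear s).

Lemma evals_eq0 s f :
  (evals s f == 0) = all (fun v : 'rV_3 => (mpoly_of_dhomog f).@[v 0] == 0) s.
Proof.
apply/eqP/(all_nthP 0) => [fs i lti|fs].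
  by have /rowP/(_ (Ordinal lti)) := fs; rewrite !mxE /= => ->.
by apply/rowP => i; rewrite !mxE; apply/eqP/fs.
Qed.

(** Each evaluation at a vector costs at most one dimension; this gives upper
    bounds (W = 0) as well as lower bounds (V the whole space). *)
Lemma dim_le_evals s V W :
  (forall f, f \in V ->
     all (fun v : 'rV_3 => (mpoly_of_dhomog f).@[v 0] == 0) s -> f \in W) ->
  (\dim V <= size s + \dim W)%N.
Proof.
move=> VW; rewrite -(limg_ker_dim (linfun (evals s)) V) addnC leq_add //.
  by rewrite (leq_trans (dimvS (subvf _))) // dim_rV.
apply/dimvS/subvP => f; rewrite memv_cap memv_ker lfunE /= evals_eq0.
by case/andP; apply: VW.
Qed.

(** The forms f are dual to the evaluations, which are therefore independent. *)
Lemma dim_evals_indep s W :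
  (forall i, (i < size s)%N -> exists f,
     forall k, (k < size s)%N ->
       ((mpoly_of_dhomog f).@[s`_k 0] == 0) = (k != i)) ->
  (forall f, f \in W ->
     all (fun v : 'rV_3 => (mpoly_of_dhomog f).@[v 0] == 0) s) ->
  (\dim W + size s <= \dim {: dhomog 3 F d})%N.
Proof.
move=> indep Ws; rewrite -(limg_ker_dim (linfun (evals s)) fullv).
rewrite leq_add //.
  apply/dimvS/subvP => f fW; rewrite memv_cap memvf memv_ker lfunE /=.
  by rewrite evals_eq0; apply: Ws.
have -> : limg (linfun (evals s)) = fullv; last by rewrite dim_rV.
apply/eqP; rewrite eqEsubv subvf; apply/subvP => v _.
rewrite [v]row_sum_delta; apply: rpred_sum => i _; apply: rpredZ.
have [f fP] := indep i (ltn_ord i).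
have fi : (mpoly_of_dhomog f).@[s`_i 0] != 0 by rewrite fP ?ltn_ord // eqxx.
apply/memv_imgP; exists ((mpoly_of_dhomog f).@[s`_i 0]^-1 *: f); first exact: memvf.
rewrite lfunE /=; apply/rowP => k; rewrite !mxE eqxx /= mevalZ eq_sym.
have [->|ki] := eqVneq k i; first by rewrite mulVf.
have /eqP -> : (mpoly_of_dhomog f).@[s`_k 0] == 0 by rewrite fP ?ltn_ord.
by rewrite mulr0.
Qed.

Lemma dim_dhomog3 : \dim {: dhomog 3 F d} = 'C(d.+2, 2).
Proof.
rewrite dimvf /dim /= -addn2.
by rewrite add0n addn2 -(@bin_sub d.+2 2) // -addn2 addnK.
Qed.

End EvaluationCount.

(** * Interpolation along a family of lines *)

Section Interpolation.

(** Over a domain that is not a field the differences of the roots need not be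
    invertible, so factors are removed one at a time by cancellation. *)
Lemma roots_factor (D : idomainType) (P : {poly D}) (rs : seq D) :
  uniq rs -> all (root P) rs -> exists Q, P = Q * \prod_(x <- rs) ('X - x%:P).
Proof.
elim: rs P => [|x rs IH] P /=; first by exists P; rewrite big_nil mulr1.
move=> /andP[xrs urs] /andP[/factor_theorem[Q ->] rsP].
have [|T ->] := IH Q urs; last by exists T; rewrite big_cons mulrAC -mulrA.
apply/allP => y yrs; have := allP rsP y yrs.
by rewrite rootM root_XsubC (negPf (memPn xrs _ yrs)) orbF.
Qed.

Variable F : fieldType.
Implicit Types (p q r : {poly F}).

Lemma prod_XsubC_dvd (ts : seq F) q :
  (forall x, x \in ts -> ('X - x%:P) ^+ count_mem x ts %| q) ->
  \prod_(t <- ts) ('X - t%:P) %| q.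
Proof.
elim: ts q => [|x ts IH] q tsq; first by rewrite big_nil dvd1p.
have /dvdpP[r qE] : 'X - x%:P %| q.
  apply: dvdp_trans (tsq x (mem_head _ _)).
  by rewrite /= eqxx exprS dvdp_mulIl.
rewrite big_cons qE mulrC dvdp_mul // IH // => y yts.
have := tsq y; rewrite inE yts orbT qE => /(_ isT) /=.
have [<-|xy] := eqVneq x y.
  by rewrite exprSr dvdp_mul2r // polyXsubC_eq0.
rewrite add0n Gauss_dvdpl // coprimep_expl //.
by rewrite coprimep_XsubC root_XsubC.
Qed.

(** The line of the (t, z)-plane dual to the point w.  Its root w.2 / w.1 is the
    slope of w seen from the origin; if v.1 and w.1 differ, the lines of v and w
    intersect at the abscissa that is the slope of the direction w - v. *)
Definition dual_line (w : F * F) : {poly F} := w.1 *: 'X - w.2%:P.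

Lemma horner_dual_line w t : (dual_line w).[t] = w.1 * t - w.2.
Proof. by rewrite /dual_line !hornerE. Qed.

Lemma dual_line_coef1 w : (dual_line w)`_1 = w.1.
Proof. by rewrite coefB coefZ coefX coefC /= mulr1 subr0. Qed.

Lemma size_dual_line w : (size (dual_line w) <= 2)%N.
Proof.
rewrite /dual_line -polyCN (leq_trans (size_polyD _ _)) // geq_max.
by rewrite (leq_trans (size_scale_leq _ _)) ?size_polyX // (leq_trans (size_polyC_leq1 _)).
Qed.

Lemma size_prod_leq (I : Type) (s : seq I) (G : I -> {poly F}) :
  (forall i, size (G i) <= 2)%N -> (size (\prod_(i <- s) G i)%R <= (size s).+1)%N.
Proof.
move=> sG; elim: s => [|i s IH]; first by rewrite big_nil size_poly1.
rewrite big_cons; apply: leq_trans (size_polyMleq _ _) _.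
by have := leq_add (sG i) IH; rewrite add2n; case: (_ + _)%N.
Qed.

Lemma size_prod_lines (I : eqType) (s : seq I) (G : I -> {poly F}) :
  (forall i, i \in s -> size (G i) = 2) ->
  size (\prod_(i <- s) G i) = (size s).+1.
Proof.
elim: s => [|i s IH] sG; first by rewrite big_nil size_poly1.
have {}IH : size (\prod_(i <- s) G i) = (size s).+1.
  by apply: IH => k ks; rewrite sG // inE ks orbT.
have Gi := sG i (mem_head _ _).
by rewrite big_cons size_mul -?size_poly_eq0 ?IH ?Gi.
Qed.

(** The interpolation problem that carries the existence of the curve: the value
    w.1 * p is prescribed along the line dual to w, and C solves it for the
    points of ws.  To correct C on one more line, its defect there must be
    divisible by the product of the differences with the previous lines.  This is
    checked at each root s of p.  Let p = q * ('X - s), and let v range over the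
    points whose line meets that of w above s, at height y.  Along these lines
    v.1 * ('X - s) = z - y, so the prescribed value is that of the single
    polynomial (z - y) * q in z.  Thus H = C - (z - y) * q vanishes on all these
    lines, is divisible by the product of their equations, and restricts to the
    defect of C along the line of w. *)
Lemma interpolation_step_dvd p (ws : seq (F * F)) (w : F * F)
    (C : {poly {poly F}}) :
  uniq ws -> w \notin ws ->
  {in w :: ws &, forall v v', v != v' -> v.1 != v'.1} ->
  (forall v, v \in ws -> exists2 s, root p s & w.2 - v.2 = s * (w.1 - v.1)) ->
  (forall v, v \in ws -> C.[dual_line v] = v.1 *: p) ->
  \prod_(v <- ws) (dual_line w - dual_line v) %| w.1 *: p - C.[dual_line w].
Proof.
move=> uws wws inj1 meet Cws.
(* The abscissa above which the lines of v and w meet. *)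
pose sg v := (w.2 - v.2) / (w.1 - v.1).
have w1 v : v \in ws -> w.1 - v.1 != 0.
  move=> vws; rewrite subr_eq0 inj1 ?mem_head ?inE ?vws ?orbT //.
  by rewrite eq_sym (memPn wws).
have sgE v : v \in ws -> dual_line w - dual_line v = (w.1 - v.1) *: ('X - (sg v)%:P).
  move=> /w1 wv; have e : (w.1 - v.1) * sg v = w.2 - v.2 by rewrite mulrC divfK.
  rewrite /dual_line scalerBr -[_ *: (sg v)%:P]mul_polyC -polyCM e.
  by rewrite -!mul_polyC !polyCB; ring.
have rsg v : v \in ws -> root p (sg v).
  by move=> vws; have [s ps e] := meet v vws; rewrite /sg e mulfK ?w1.
rewrite (eq_big_seq (fun v => (w.1 - v.1)%:P * ('X - (sg v)%:P))); last first.
  by move=> v vws; rewrite sgE // mul_polyC.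
rewrite big_split /= -rmorph_prod mul_polyC dvdpZl; last first.
  by rewrite prodf_seq_neq0; apply/allP => v /w1.
rewrite -(big_map sg predT (fun t => 'X - t%:P)).
apply: prod_XsubC_dvd => s /mapP[v0 v0ws s0].
have /factor_theorem[q pE] : root p s by rewrite s0 rsg.
rewrite count_map -size_filter.
set cl := filter _ ws.
have clP v : v \in cl -> v \in ws /\ sg v = s.
  by rewrite mem_filter => /andP[/eqP].
pose y := (dual_line w).[s].
have lineE v : sg v = s -> v \in ws -> dual_line v = y%:P + v.1%:P * ('X - s%:P).
  move=> vs vws; have := sgE v vws; rewrite vs => e.
  have -> : dual_line v = dual_line w - (w.1 - v.1) *: ('X - s%:P).
    by rewrite -e; ring.
  by rewrite /y horner_dual_line /dual_line -!mul_polyC !polyCB polyCM; ring.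
have lineEw : dual_line w = y%:P + w.1%:P * ('X - s%:P).
  by rewrite /y horner_dual_line /dual_line -!mul_polyC polyCB polyCM; ring.
pose H : {poly {poly F}} := C - ('X - (y%:P)%:P) * q%:P.
have Hline v : dual_line v = y%:P + v.1%:P * ('X - s%:P) ->
    H.[dual_line v] = C.[dual_line v] - v.1 *: p.
  by move=> e; rewrite /H !hornerE {2}e pE -mul_polyC; ring.
have [||G HG] := @roots_factor _ H (map dual_line cl).
- rewrite map_inj_in_uniq ?filter_uniq // => v v' /clP[vws _] /clP[vws' _] e.
  have : v.1 = v'.1 by rewrite -!dual_line_coef1 e.
  by apply: contra_eq => /inj1; apply; rewrite inE ?vws ?vws' orbT.
- apply/allP => _ /mapP[v /clP[vws vs] ->]; rewrite /root Hline ?lineE //.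
  by rewrite -lineE // Cws // subrr.
have := Hline w lineEw; rewrite HG hornerM => e.
rewrite -[_ - C.[_]]opprB -e dvdpNr dvdp_mull // horner_prod big_map.
rewrite (eq_big_seq (fun v => (w.1 - v.1)%:P * ('X - s%:P))); last first.
  by move=> v /clP[vws vs]; rewrite hornerXsubC sgE // vs mul_polyC.
by rewrite big_split /= dvdp_mull // big_const_seq count_predT -Monoid.iteropE.
Qed.
(** Newton interpolation, one line at a time, starting from z * p / ('X - s0).
    The second conclusion expresses, by substitution of affine functions k for z,
    that C has total degree at most m and that its part of degree m is a multiple
    of z * 'X^(m-1).  Under it the defect along a new line has degree less than m, so
    the correction term keeps the degree bound; once there are m lines or more,
    the defect is divisible by a polynomial of degree at least m, hence zero. *)
Lemma dual_lines_interpolation p m s0 (ws : seq (F * F)) :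
  (size p <= m.+1)%N -> root p s0 -> uniq ws ->
  {in ws &, forall v v', v != v' -> v.1 != v'.1} ->
  {in ws &, forall v v', v != v' ->
     exists2 s, root p s & v.2 - v'.2 = s * (v.1 - v'.1)} ->
  exists C : {poly {poly F}},
    (forall v, v \in ws -> C.[dual_line v] = v.1 *: p) /\
    (forall k, size (C.[dual_line k] - k.1 *: p)%R <= m)%N.
Proof.
move=> sp /factor_theorem[q pE]; elim: ws => [|w ws IH] /=.
  move=> _ _ _; exists (q%:P * 'X); split=> // k.
  have -> : (q%:P * 'X).[dual_line k] - k.1 *: p = (k.1 * s0 - k.2) *: q.
    by rewrite !hornerE pE /dual_line -!mul_polyC polyCB polyCM; ring.
  apply: leq_trans (size_scale_leq _ _) _.
  have [->|q0] := eqVneq q 0; first by rewrite size_poly0.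
  by move: sp; rewrite pE size_Mmonic ?monicXsubC // size_XsubC addn2.
move=> /andP[wws uws] inj1 meet.
have subw v : v \in ws -> v \in w :: ws by rewrite inE orbC => ->.
have [||C [Cws Csize]] := IH uws.
- by move=> v v' /subw vw /subw; apply: inj1.
- by move=> v v' /subw vw /subw; apply: meet.
have /dvdpP[c cE] : \prod_(v <- ws) (dual_line w - dual_line v)
    %| w.1 *: p - C.[dual_line w].
  apply: interpolation_step_dvd => // v vws.
  by apply: meet; rewrite ?mem_head ?subw // eq_sym (memPn wws).
exists (C + c%:P * \prod_(v <- ws) ('X - (dual_line v)%:P)).
have ev k : (C + c%:P * \prod_(v <- ws) ('X - (dual_line v)%:P)).[k]
    = C.[k] + c * \prod_(v <- ws) (k - dual_line v).
  rewrite hornerD hornerM hornerC horner_prod; congr (_ + _ * _).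
  by apply: eq_bigr => v _; rewrite hornerXsubC.
split=> [v|k]; rewrite ev.
  rewrite inE => /orP[/eqP ->|vws]; first by rewrite -cE addrC subrK.
  rewrite Cws // (big_rem v) //= subrr mul0r mulr0 addr0 //.
rewrite addrAC (leq_trans (size_polyD _ _)) // geq_max Csize /=.
have [->|c0] := eqVneq c 0; first by rewrite mul0r size_poly0.
have lineB v v' : (size (dual_line v - dual_line v')%R <= 2)%N.
  have -> : dual_line v - dual_line v' = dual_line (v.1 - v'.1, v.2 - v'.2).
    by rewrite /dual_line -!mul_polyC /= !polyCB; ring.
  exact: size_dual_line.
have sD : size (\prod_(v <- ws) (dual_line w - dual_line v)) = (size ws).+1.
  apply: size_prod_lines => v vws; apply/eqP; rewrite eqn_leq lineB ltnNge.
  apply: contraTN (inj1 w v (mem_head _ _) (subw _ vws) _) => [/leq_sizeP/(_ 1%N)|].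
    by rewrite coefB !dual_line_coef1 => /(_ isT)/eqP; rewrite subr_eq0 negbK.
  by rewrite eq_sym (memPn wws).
have := Csize w; rewrite -opprB size_polyN cE size_mul //; last first.
  by rewrite -size_poly_eq0 sD.
rewrite sD addnS /= => cm; apply: leq_trans (size_polyMleq _ _) _.
apply: leq_trans cm; rewrite -subn1 leq_subLR add1n -addnS leq_add2l.
exact: size_prod_leq.
Qed.

(** Evaluating the interpolating polynomial at z = 0 gives g, because the line
    dual to v vanishes at the slope t of v. *)
Lemma supersolvable_interpolation p m s0 (ws : seq (F * F)) :
  (size p <= m.+1)%N -> root p s0 -> uniq ws ->
  {in ws &, forall v v', v != v' -> v.1 != v'.1} ->
  {in ws &, forall v v', v != v' ->
     exists2 s, root p s & v.2 - v'.2 = s * (v.1 - v'.1)} ->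
  exists2 g : {poly F}, (size g <= m)%N &
    forall v t, v \in ws -> v.1 * t = v.2 -> g.[t] = v.1 * p.[t].
Proof.
move=> sp ps0 uws inj1 meet.
have [C [Cws Csize]] := dual_lines_interpolation sp ps0 uws inj1 meet.
have zero_line : dual_line (0, 0) = 0 by rewrite /dual_line scale0r subr0.
exists C.[0]; first by have := Csize (0, 0); rewrite zero_line scale0r subr0.
move=> v t vws vt; rewrite -[v.1 * _]hornerZ -Cws //.
rewrite -!horner_evalE -!(horner_map (horner_eval t)) /= !horner_evalE.
by rewrite horner_dual_line vt subrr horner0.
Qed.


End Interpolation.

(** * Projection from a general point *)

Section Frame.
Variable F : numFieldType.
Implicit Types (p q u v z : 'rV[F]_3) (zs : seq 'rV[F]_3) (f : {mpoly F[3]}).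

(** q lies on no line through two points of zs, so that projecting from q
    separates these points. *)
Definition general_for zs q :=
  {in zs &, forall z z', z != z' -> det3 q z z' != 0}.

Lemma general_for_cross zs q : uniq zs -> (1 < size zs)%N -> general_for zs q ->
  {in zs, forall z, cross q z != 0}.
Proof.
move=> uzs szs qzs z zzs.
have [z' z'zs z'z] : exists2 z', z' \in zs & z' != z.
  apply/hasP; apply: contraTT szs => /hasPn eqz.
  rewrite -leqNgt -[1%N]/(size [:: z]) uniq_leq_size // => z' /eqz.
  by rewrite negbK inE.
have := qzs z z' zzs z'zs; rewrite eq_sym z'z => /(_ isT).
by apply: contraNneq => c0; rewrite /det3 c0 dotC dot0r.
Qed.

(** Coordinates (s, x, y) adapted to the projection from q: the line p is s = 0,
    and the line through q and e2, on which x vanishes, avoids zs, so that every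
    point of zs has a finite slope y / x. *)
Record frame zs p q (e1 e2 s x y : 'rV[F]_3) : Prop := Frame {
  frame_p1 : dot p e1 = 0;
  frame_p2 : dot p e2 = 0;
  frame_dec : forall v, v = dot s v *: q + dot x v *: e1 + dot y v *: e2;
  frame_dual : forall a b c, let v := a *: q + b *: e1 + c *: e2 in
    [/\ dot s v = a, dot x v = b & dot y v = c];
  frame_x : {in zs, forall z, dot x z != 0} }.

(** Vectors of the line p are of the form cross r p, and the determinants that
    must not vanish are linear in r; identity double_cross shows that they are
    not identically zero. *)
Lemma frame_exists zs p q :
  uniq zs -> (1 < size zs)%N -> dot p q != 0 -> general_for zs q ->
  exists e1 e2 s x y, frame zs p q e1 e2 s x y.
Proof.
move=> uzs szs pq qgen; have qzs := general_for_cross uzs szs qgen.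
have in_plane r v : dot (cross r p) v = dot (cross p v) r.
  by rewrite -!/(det3 _ _ _) det3C.
pose avoid := [seq cross p (cross q z) | z <- zs].
have [|r _ rP] := generic_vector (oner_neq0 _ : (1 : {mpoly F[3]}) != 0)
    (_ : 0 \notin avoid).
  apply/mapP => -[z /qzs qz]; rewrite double_cross => /esym/eqP.
  rewrite subr_eq0 => /eqP zq; case/eqP: qz.
  have -> : z = (dot p z / dot p q) *: q.
    by apply: (scalerI pq); rewrite -zq scalerA mulrC divfK.
  by apply/rowP => i; rewrite !mxE; ring.
pose e2 := cross r p.
have e2z : {in zs, forall z, det3 q z e2 != 0}.
  by move=> z zzs; rewrite /det3 dotC in_plane; apply/rP/map_f.
have e20 : e2 != 0.
  case: zs {uzs qgen qzs avoid rP} szs e2z => // z zs _ /(_ z (mem_head _ _)).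
  by apply: contraNneq => ->; rewrite /det3 dot0r.
have [|r' _ r'P] := generic_vector (oner_neq0 _ : (1 : {mpoly F[3]}) != 0)
    (_ : 0 \notin [:: cross p (cross e2 q)]).
  rewrite inE double_cross /e2 dot_crossr scale0r subr0 eq_sym.
  by rewrite scaler_eq0 negb_or pq.
pose e1 := cross r' p; pose D := det3 q e1 e2.
have D0 : D != 0.
  by rewrite /D det3C det3C /det3 dotC in_plane r'P ?mem_head.
exists e1, e2, (D^-1 *: cross e1 e2), (D^-1 *: cross e2 q), (D^-1 *: cross q e1).
have dotZl c u v : dot (c *: u) v = c * dot u v by rewrite dotC dotZr dotC.
split; rewrite ?dot_crossr //.
- move=> v; apply: (scalerI D0); rewrite !dotZl cramer3 !scalerDr !scalerA.
  rewrite !mulrA divff // !mul1r -/(det3 _ _ _) -/(det3 _ _ _) -/(det3 _ _ _).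
  by rewrite (det3C v) (det3C q v) (det3C v e2).
- move=> a b c /=; rewrite !dotZl !dotDr !dotZr -!/(det3 _ _ _).
  have -> : det3 e1 e2 q = D by rewrite det3C det3C.
  have -> : det3 e2 q e1 = D by rewrite det3C.
  have det3_z u v : det3 u v u = 0 by rewrite -det3C det3_id.
  have det3_z' u v : det3 u v v = 0 by rewrite det3C det3_id.
  by rewrite -/D !det3_z !det3_z' !mulr0 !addr0 !add0r; split; field.
move=> z /e2z qz; rewrite dotZl mulf_neq0 ?invr_eq0 // -/(det3 _ _ _).
by rewrite det3C.
Qed.
End Frame.

(** * Bound on curves with a point of large multiplicity *)

Section Slopes.
Variables (F : numFieldType) (zs : seq 'rV[F]_3) (p q e1 e2 s x y : 'rV[F]_3).
Hypotheses (pq : dot p q != 0) (qgen : general_for zs q).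
Hypothesis fr : frame zs p q e1 e2 s x y.
Implicit Types (v z : 'rV[F]_3) (f : {mpoly F[3]}).

(** The coordinate on the pencil of lines through q. *)
Definition slope v := dot y v / dot x v.

Lemma dot_frame v : dot p v = dot s v * dot p q.
Proof.
rewrite {1}(frame_dec fr v) !dotDr !dotZr (frame_p1 fr) (frame_p2 fr).
by rewrite !mulr0 !addr0.
Qed.

Lemma frame_s_eq0 v : (dot s v == 0) = (dot p v == 0).
Proof. by rewrite dot_frame mulf_eq0 (negPf pq) orbF. Qed.

Lemma slope_dec v : dot x v != 0 ->
  v = dot x v *: ((dot s v / dot x v) *: q + (e1 + slope v *: e2)).
Proof.
move=> xv; rewrite {1}(frame_dec fr v) !scalerDr !scalerA /slope.
by rewrite ![dot x v * _]mulrC !divfK // addrA.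
Qed.


Lemma slope_inj : {in zs &, injective slope}.
Proof.
move=> z z' zzs z'zs ezz'; apply: contraTeq isT => /(qgen zzs z'zs)/eqP[].
have [xz xz'] := (frame_x fr zzs, frame_x fr z'zs).
rewrite (slope_dec xz') -ezz'.
have -> : e1 + slope z *: e2
    = (dot x z)^-1 *: z - (dot s z / dot x z) *: q.
  by rewrite [X in _ = _ *: X - _](slope_dec xz) scalerA mulVf // scale1r addrAC subrr add0r.
rewrite det3Zr !det3Dr -scaleNr !det3Zr.
have -> : det3 q z q = 0 by rewrite -det3C det3_id.
have -> : det3 q z z = 0 by rewrite det3C det3_id.
by rewrite !mulr0 !addr0 mulr0.
Qed.

(** Upper bound for the curves of degree j + 1 with a point of multiplicity j at
    Q.  Such a curve f is determined by its trace on the line p, a binary form of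
    degree j + 1, and by the slope of its affine dependence on the coordinate s,
    a binary form of degree j.  The first vanishes at the points of zs on p.  If
    it is zero, the second vanishes at the slopes of the other points of zs.  The
    additional zeros xs and ys make both numbers of zeros exceed the degree. *)
Lemma fat_curve_eq0 (Q : point F) j (xs ys : seq F) f :
  uniq zs -> q \in point_space Q -> f \is j.+1.-homog ->
  ideal_exp (vanishing_ideal [fset Q]%fset) j f ->
  (forall z, z \in zs -> f.@[z 0] = 0) ->
  (forall t, t \in xs -> f.@[(e1 + t *: e2) 0] = 0) ->
  (forall t, t \in ys -> f.@[(q + e1 + t *: e2) 0] = 0) ->
  uniq xs -> uniq ys ->
  (forall t, t \in xs ++ ys -> t \notin map slope zs) ->
  (j.+1 < count (on_line p) zs + size xs)%N ->
  (j < count (predC (on_line p)) zs + size ys)%N ->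
  f = 0.
Proof.
move=> uzs qQ fj fQ fzs fxs fys uxs uys fresh on_xs off_ys.
pose sl (P : pred 'rV[F]_3) := [seq slope z | z <- zs & P z].
have usl P ts : uniq ts -> (forall t, t \in ts -> t \in xs ++ ys) ->
    uniq (sl P ++ ts).
  move=> uts tsP; rewrite cat_uniq uts map_inj_in_uniq ?filter_uniq //=.
    rewrite andbT; apply/hasPn => t /tsP/fresh; apply: contra => /mapP[z].
    by rewrite mem_filter => /andP[_ zzs] ->; apply: map_f.
  move=> z z'; rewrite !mem_filter => /andP[_ zzs] /andP[_ z'zs].
  exact: slope_inj.
have ev0 z : z \in zs ->
    f.@[((dot s z / dot x z) *: q + (e1 + slope z *: e2)) 0] = 0.
  move=> zzs; have := fzs z zzs; have xz := frame_x fr zzs.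
  rewrite {1}(slope_dec xz) (meval_homogZ _ _ fj) => /eqP.
  by rewrite mulf_eq0 expf_eq0 (negPf xz) andbF => /eqP.
have [sh ch] := line_restr_homog e1 e2 fj.
have h0 : line_restr e1 e2 f = 0.
  apply: contraTeq on_xs => h0; rewrite -leqNgt.
  have /(_ _ h0) := @max_poly_roots _ _ (sl (on_line p) ++ xs).
  rewrite size_cat size_map size_filter => ub; rewrite -ltnS.
  apply: leq_trans (ub _ _) sh; last by apply: usl => // t txs; rewrite mem_cat txs.
  rewrite all_cat; apply/andP; split; apply/allP => t; last first.
    by move=> /fxs ft; rewrite rootE horner_line_restr ft.
  case/mapP => z; rewrite mem_filter /on_line -frame_s_eq0 => /andP[/eqP sz zzs] ->.
  by have := ev0 z zzs; rewrite rootE horner_line_restr sz mul0r scale0r add0r => ->.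
have fL t : f.@[(e1 + t *: e2) 0] = 0 by rewrite -horner_line_restr h0 horner0.
have f_move a t : f.@[(a *: q + (e1 + t *: e2)) 0] = a * f.@[(q + e1 + t *: e2) 0].
  by rewrite (fat_meval _ _ fj qQ fQ) fL addr0 subr0 addrA.
have [sg cg] := line_restr_homog (q + e1) e2 fj.
(* The degree drops by one since f vanishes at e2, a point of the line p. *)
have {}sg : (size (line_restr (q + e1) e2 f) <= j.+1)%N.
  apply/leq_sizeP => i; rewrite leq_eqVlt => /orP[/eqP <-|].
    by rewrite cg -ch h0 coef0.
  by move: i; apply/leq_sizeP.
have g0 : line_restr (q + e1) e2 f = 0.
  apply: contraTeq off_ys => g0; rewrite -leqNgt.
  have /(_ _ g0) := @max_poly_roots _ _ (sl (predC (on_line p)) ++ ys).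
  rewrite size_cat size_map size_filter => ub; rewrite -ltnS.
  apply: leq_trans (ub _ _) sg; last first.
    by apply: usl => // t tys; rewrite mem_cat tys orbT.
  rewrite all_cat; apply/andP; split; apply/allP => t; last first.
    by move=> /fys ft; rewrite rootE horner_line_restr ft.
  case/mapP => z; rewrite mem_filter /= /on_line -frame_s_eq0 => /andP[sz zzs] ->.
  have := ev0 z zzs; rewrite f_move rootE horner_line_restr => /eqP.
  by rewrite mulf_eq0 mulf_eq0 invr_eq0 (negPf sz) (negPf (frame_x fr zzs)).
have x0 : linform x != 0.
  rewrite linform_eq0; have [_ + _] := frame_dual fr 0 1 0; apply: contra_eqN.
  by move=> /eqP ->; rewrite dotC dot0r eq_sym oner_eq0.
apply: contra_eq (erefl (f * linform x)) => f0.
have /mpoly_nonzero_point[v] : f * linform x != 0 by rewrite mulf_neq0.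
rewrite mevalM meval_linform mulf_eq0 negb_or => /andP[fv xv]; case/negP: fv.
rewrite (slope_dec xv) (meval_homogZ _ _ fj) f_move -horner_line_restr g0.
by rewrite horner0 !mulr0.
Qed.

End Slopes.

(** * Existence of the curve of degree m *)

Section Curve.
Variables (F : numFieldType) (zs : seq 'rV[F]_3) (p q e1 e2 s x y : 'rV[F]_3).
Hypotheses (pq : dot p q != 0) (qgen : general_for zs q).
Hypothesis fr : frame zs p q e1 e2 s x y.
Implicit Types (v z : 'rV[F]_3) (f : {mpoly F[3]}).

Implicit Type g : {poly F}.

(** The homogenization of g to degree n in the linear forms x and y. *)
Definition binary_form n (g : {poly F}) : {mpoly F[3]} :=
  \sum_(i < n.+1) g`_i *: (linform x ^+ (n - i) * linform y ^+ i).

Lemma binary_form_homog n g : binary_form n g \is n.-homog.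
Proof.
apply: rpred_sum => i _; apply: rpredZ.
have hpow (l : 'rV[F]_3) k : linform l ^+ k \is k.-homog.
  by have := dhomogMn k (linform_homog l); rewrite mul1n.
have := dhomogM (hpow x (n - i)%N) (hpow y i).
by rewrite subnK // -ltnS.
Qed.

Lemma meval_binary_form n g v : (size g <= n.+1)%N -> dot x v != 0 ->
  (binary_form n g).@[v 0] = dot x v ^+ n * g.[slope x y v].
Proof.
move=> sg xv; rewrite raddf_sum (horner_coef_wide _ sg) mulr_sumr.
apply: eq_bigr => i _; rewrite [LHS]mevalZ mevalM !rmorphXn /= !meval_linform.
rewrite [RHS]mulrCA; congr (_ * _).
rewrite /slope exprMn [RHS]mulrCA [LHS]mulrC; congr (_ * _).
have le_in : (i <= n)%N by rewrite -ltnS.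
have -> : dot x v ^+ n = dot x v ^+ (n - i) * dot x v ^+ i by rewrite -exprD subnK.
by rewrite -mulrA -exprMn divff // expr1n mulr1.
Qed.

Lemma ideal_expZ (Q : point F) j f (g : {mpoly F[3]}) :
  ideal_exp (vanishing_ideal [fset Q]%fset) j f ->
  ideal_exp (vanishing_ideal [fset Q]%fset) j (g * f).
Proof.
elim: j f => [//|j IH] f [t tP ->].
exists [seq (gh.1, g * gh.2) | gh <- t].
  by move=> _ /mapP[gh /tP[gh1 gh2] ->]; split=> //; apply: IH.
by rewrite big_map mulr_sumr; apply: eq_bigr => gh _ /=; rewrite mulrCA.
Qed.

(** The forms x and y vanish at q. *)
Lemma ideal_exp_binary (Q : point F) n g :
  (point_space Q = <[q]>)%VS ->
  ideal_exp (vanishing_ideal [fset Q]%fset) n (binary_form n g).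
Proof.
move=> Qq; have lin l : dot l q = 0 ->
    vanishing_ideal [fset Q]%fset (linform l).
  move=> lq P; rewrite inE => /eqP -> v.
  by rewrite Qq => /vlineP[a ->]; rewrite meval_linform dotZr lq mulr0.
have [_ xq yq] : [/\ dot s q = 1, dot x q = 0 & dot y q = 0].
  by have := frame_dual fr 1 0 0; rewrite /= scale1r !scale0r !addr0.
have mono a b : ideal_exp (vanishing_ideal [fset Q]%fset) (a + b)
    (linform x ^+ a * linform y ^+ b).
  have step l h k : dot l q = 0 ->
      ideal_exp (vanishing_ideal [fset Q]%fset) k h ->
      ideal_exp (vanishing_ideal [fset Q]%fset) k.+1 (linform l * h).
    move=> lq kh; exists [:: (linform l, h)]; last by rewrite big_seq1.
    by move=> gh; rewrite inE => /eqP -> /=; split => //; apply: lin.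
  elim: a => [|a IH]; last by rewrite exprS -mulrA addSn; apply: step.
  rewrite expr0 mul1r add0n; elim: b => [//|b IH].
  by rewrite exprS; apply: step.
have [I0 IL] := ideal_exp_subspace n (vanishing_ideal_subspace [fset Q]%fset).
rewrite /binary_form; elim/big_rec: _ => // i f _; apply: IL.
by have := mono (n - i)%N i; rewrite subnK // -ltnS.
Qed.

Lemma ideal_exp_le (Q : point F) n f :
  ideal_exp (vanishing_ideal [fset Q]%fset) n.+1 f ->
  ideal_exp (vanishing_ideal [fset Q]%fset) n f.
Proof.
have [I0 IL] := ideal_exp_subspace n (vanishing_ideal_subspace [fset Q]%fset).
move=> [t tP {f}->]; rewrite big_seq; elim/big_rec: _ => // gh f ght fn.
rewrite -[_ * _]scale1r; apply: IL => //; apply: ideal_expZ.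
by have [] := tP _ ght.
Qed.

(** In coordinates the curve is s G(x, y) = P(x, y), where P is the product of
    the lines joining q to the points of zs on the line p, and G is the binary
    form of degree m of an interpolating polynomial g.  A point off p with affine
    coordinates (a, b) = (x / s, y / s) lies on the curve if g(t) = a P(1, t) for
    its slope t.  Modularity says that the line through two such points meets p
    in a point of zs, that is, that the direction of their difference is a root
    of P: this is the hypothesis of supersolvable_interpolation. *)
Lemma supersolvable_curve (Q : point F) m :
  (point_space Q = <[q]>)%VS -> uniq zs ->
  pairwise_indep zs ->
  count (on_line p) zs = m.+1 ->
  {in zs &, forall z z', z != z' -> ~~ on_line p z -> ~~ on_line p z' ->
     exists2 z'', z'' \in zs & on_line p z'' /\ det3 z z' z'' = 0} ->
  exists f, [/\ f != 0, f \is m.+1.-homog,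
    ideal_exp (vanishing_ideal [fset Q]%fset) m f &
    forall z, z \in zs -> f.@[z 0] = 0].
Proof.
move=> Qq uzs indep onm modular.
pose on := [seq z <- zs | on_line p z]; pose off := [seq z <- zs | ~~ on_line p z].
have onP z : (z \in on) = (dot s z == 0) && (z \in zs).
  by rewrite mem_filter /on_line (frame_s_eq0 pq fr).
have offP z : (z \in off) = (dot s z != 0) && (z \in zs).
  by rewrite mem_filter /on_line (frame_s_eq0 pq fr).
pose pol := \prod_(z <- on) ('X - (slope x y z)%:P).
have spol : size pol = m.+2 by rewrite size_prod_XsubC size_filter onm.
have root_pol z : z \in on -> root pol (slope x y z).
  move=> zon; rewrite /pol -(big_map (slope x y) predT (fun t => 'X - t%:P)).
  by rewrite root_prod_XsubC map_f.
have [z0 z0on] : exists z0, z0 \in on.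
  have : has (on_line p) zs by rewrite has_count onm.
  by case/hasP => z zzs zon; exists z; rewrite mem_filter zon.
pose aff z := (dot x z / dot s z, dot y z / dot s z).
have affP : {in off &, forall z z', z != z' -> (aff z).1 != (aff z').1 /\
    exists2 t, root pol t & (aff z).2 - (aff z').2 = t * ((aff z).1 - (aff z').1)}.
  move=> z z'; rewrite !offP => /andP[sz zzs] /andP[sz' z'zs] zz'.
  have [||z2 z2zs [z2on /(coplanar_span (indep _ _ zzs z'zs zz'))[a [b z2E]]]] :=
    modular z z' zzs z'zs zz'; rewrite ?/on_line -?(frame_s_eq0 pq fr) //.
  have z2on' : z2 \in on by rewrite mem_filter z2on.
  have xz2 := frame_x fr z2zs.
  have sz2 : a * dot s z + b * dot s z' = 0.
    by rewrite -!dotZr -dotDr -z2E; apply/eqP; rewrite (frame_s_eq0 pq fr).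
  (* z2 lies on p, so it is proportional to the difference of the affine
     representatives of z and z'. *)
  have bE : b = - (a * dot s z / dot s z').
    by apply: (mulIf sz'); rewrite mulNr divfK //; apply/eqP; rewrite -addr_eq0 addrC sz2.
  have e1E : dot x z2 = a * dot s z * ((aff z).1 - (aff z').1).
    by rewrite z2E dotDr !dotZr bE /aff /=; field; rewrite sz sz'.
  have e2E : dot y z2 = a * dot s z * ((aff z).2 - (aff z').2).
    by rewrite z2E dotDr !dotZr bE /aff /=; field; rewrite sz sz'.
  move: (xz2); rewrite e1E mulf_eq0 negb_or subr_eq0 => /andP[k0 ne]; split=> //.
  exists (slope x y z2); first exact: root_pol.
  apply: (mulfI k0); rewrite -e2E mulrCA -e1E /slope divfK //.
have [|||||g sg gP] := @supersolvable_interpolation F pol m.+1 (slope x y z0) (map aff off).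
- by rewrite spol.
- exact: root_pol.
- rewrite map_inj_in_uniq ?filter_uniq // => z z' zo z'o e.
  by apply: contra_eq (congr1 fst e) => /(affP z z' zo z'o)[].
- move=> _ _ /mapP[z zo ->] /mapP[z' z'o ->] ne.
  have nz : z != z' by apply: contraNneq ne => ->.
  by have [] := affP z z' zo z'o nz.
- move=> _ _ /mapP[z zo ->] /mapP[z' z'o ->] ne.
  have nz : z != z' by apply: contraNneq ne => ->.
  by have [] := affP z z' zo z'o nz.
exists (linform s * binary_form m g - binary_form m.+1 pol); split.
(* On the line p, where s = 0, the curve is cut out by pol. *)
- have pol0 : pol != 0 by rewrite -size_poly_eq0 spol.
  have [t pt] := nonroot_exists pol0.
  apply: contraNneq pt => f0; pose v := 0 *: q + 1 *: e1 + t *: e2.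
  have [] := frame_dual fr 0 1 t; rewrite -/v => sv xv yv.
  have := congr1 (meval (v 0)) f0.
  rewrite meval0 mevalB mevalM meval_linform sv mul0r sub0r.
  rewrite meval_binary_form ?spol // /slope xv ?oner_eq0 // yv expr1n mul1r divr1.
  by move/eqP; rewrite oppr_eq0.
- apply: rpredB; last exact: binary_form_homog.
  exact: dhomogM (linform_homog s) (binary_form_homog m g).
- have [_ IL] := ideal_exp_subspace m (vanishing_ideal_subspace [fset Q]%fset).
  rewrite addrC -scaleN1r; apply: IL.
    exact/ideal_exp_le/ideal_exp_binary.
  exact/ideal_expZ/ideal_exp_binary.
move=> z zzs; have xz := frame_x fr zzs.
rewrite mevalB mevalM meval_linform !meval_binary_form ?spol //.
have [sz|sz] := eqVneq (dot s z) 0.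
  have : root pol (slope x y z) by apply: root_pol; rewrite onP sz eqxx.
  by rewrite sz mul0r sub0r => /eqP ->; rewrite mulr0 oppr0.
rewrite (gP (aff z)) ?map_f ?offP ?sz // /aff /slope /=; last by field; rewrite xz sz.
by rewrite exprS; field.
Qed.

End Curve.

(** * Independence of conditions in degree m *)

Section IndependentConditions.
Variables (F : numFieldType).
Implicit Types (u v w z : 'rV[F]_3) (zs us : seq 'rV[F]_3)
  (ps : seq ('rV[F]_3 * 'rV[F]_3)).

(** The union of the lines joining the pairs of ps. *)
Definition chords ps : {mpoly F[3]} := \prod_(c <- ps) linform (cross c.1 c.2).

Lemma chords_homog ps : chords ps \is (size ps).-homog.
Proof.
elim: ps => [|c ps IH]; first by rewrite /chords big_nil dhomog1.
by rewrite /chords big_cons; exact: dhomogM (linform_homog _) IH.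
Qed.

Lemma meval_chords ps z :
  (chords ps).@[z 0] = \prod_(c <- ps) det3 c.1 c.2 z.
Proof.
rewrite /chords rmorph_prod; apply: eq_bigr => c _; exact: meval_linform.
Qed.

Lemma chords_eq0 ps c z : c \in ps -> (z == c.1) || (z == c.2) ->
  (chords ps).@[z 0] = 0.
Proof.
move=> cps zc; rewrite meval_chords (big_rem c) //=.
suff -> : det3 c.1 c.2 z = 0 by rewrite mul0r.
by case/orP: zc => /eqP ->; [rewrite -det3C det3_id | rewrite det3C det3_id].
Qed.

Lemma chords_neq0 ps z : (forall c, c \in ps -> det3 c.1 c.2 z != 0) ->
  (chords ps).@[z 0] != 0.
Proof.
by move=> psz; rewrite meval_chords prodf_seq_neq0; apply/allP.
Qed.

Variables (zs : seq 'rV[F]_3) (p : 'rV[F]_3) (m : nat).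
Hypotheses (uzs : uniq zs)
  (indep : pairwise_indep zs)
  (max_line : forall u, u != 0 -> (count (on_line u) zs <= m)%N).

(** Otherwise z and all of us would lie on one line, which has at most m points. *)
Lemma chord_avoiding z us : uniq us -> z \in zs -> {subset us <= zs} ->
  z \notin us -> (0 < m)%N -> (m <= size us)%N ->
  exists u v, [/\ u \in us, v \in us, v != u & det3 u v z != 0].
Proof.
move=> uus zzs uszs zus m0 szus.
have [u uus'] : exists u, u \in us.
  by case: us szus {uus uszs zus} => [|u us _]; [case: m m0|exists u; rewrite mem_head].
have zu : z != u by apply: contraNneq zus => ->.
suff /hasP[v vus uvz] : has (fun v => det3 u v z != 0) us.
  exists u, v; split=> //; by apply: contraNneq uvz => ->; rewrite det3_id.
apply: contraT => /hasPn noneP.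
have uz0 := indep (uszs u uus') zzs; rewrite eq_sym zu in uz0.
have := max_line (uz0 isT); rewrite leqNgt => /negP[].
apply: leq_trans (_ : (size (z :: us) <= _)%N); first by rewrite /= ltnS.
rewrite -size_filter uniq_leq_size //= ?zus // => v; rewrite inE mem_filter /on_line.
case/orP => [/eqP ->|vus]; first by rewrite dotC dot_crossr eqxx.
rewrite uszs // andbT -/(det3 u z v) -det3C.
have := noneP v vus; rewrite negbK => /eqP e.
by rewrite -oppr_eq0 -det3N e.
Qed.

Hypothesis m1 : (1 < m)%N.
Hypothesis onm : count (on_line p) zs = m.
Hypothesis szs : (2 * m < size zs)%N.

(* The 2m + 1 points whose conditions on forms of degree m are independent. *)
Let on := [seq z <- zs | on_line p z].
Let off := take m.+1 [seq z <- zs | ~~ on_line p z].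

Let on_in z : (z \in on) = on_line p z && (z \in zs).
Proof. by rewrite mem_filter. Qed.

Let off_in z : z \in off -> ~~ on_line p z /\ z \in zs.
Proof. by move/mem_take; rewrite mem_filter => /andP. Qed.

Let size_off : size off = m.+1.
Proof.
rewrite size_take_min size_filter; apply/minn_idPl.
have := count_predC (on_line p) zs; rewrite onm => e.
by rewrite -(ltn_add2l m) e addnn -mul2n.
Qed.

(** If z is on the line p, the m + 1 points off p are covered by one chord that
    avoids z and by m - 1 chords to the other points on p, which do not meet p at
    z.  If z is off p, the line p covers the points on it, and of the m other
    points off p two are on a chord avoiding z, each of the m - 2 others being on
    a line of its own. *)
Lemma separating_curve z : z \in on ++ off ->
  exists f, [/\ f \is m.-homog, f.@[z 0] != 0 &
    forall z', z' \in on ++ off -> z' != z -> f.@[z' 0] = 0].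
Proof.
have uoff : uniq off by rewrite take_uniq ?filter_uniq.
have uon : uniq on by rewrite filter_uniq.
have m0 := ltnW m1.
rewrite mem_cat => /orP[zon|zoff].
  have [z_on zzs] : on_line p z /\ z \in zs by apply/andP; rewrite -on_in.
  have zoff : z \notin off by apply: contraL z_on => /off_in[].
  have [||u [v [uo vo vu uvz]]] := chord_avoiding uoff zzs _ zoff m0.
  - by move=> v /off_in[].
  - by rewrite size_off.
  pose rest := rem v (rem u off); pose ps := (u, v) :: zip rest (rem z on).
  have srest : size rest = m.-1.
    by rewrite size_rem ?size_rem ?size_off // mem_rem_uniq // inE vu.
  have son : size (rem z on) = m.-1 by rewrite size_rem // size_filter onm.
  exists (chords ps); split.
  - by have := chords_homog ps; rewrite /= size_zip srest son minnn prednK.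
  - apply: chords_neq0 => -[r o]; rewrite inE => /orP[/eqP[-> ->] //|] /= ro.
    have /off_in[r_off rzs] : r \in off.
      suff : r \in rest by move/mem_rem/mem_rem.
      rewrite -(@unzip1_zip _ _ rest (rem z on)) ?srest ?son //.
      by apply/mapP; exists (r, o).
    have : o \in rem z on.
      by rewrite -(@unzip2_zip _ _ rest (rem z on)) ?srest ?son //; by apply/mapP; exists (r, o).
    rewrite mem_rem_uniq // inE on_in => /and3P[oz o_on ozs].
    rewrite det3C; apply: contra r_off => /eqP/coplanar_span[|a [b ->]].
      exact: indep.
    by rewrite /on_line dotDr !dotZr (eqP o_on) (eqP z_on) !mulr0 addr0.
  move=> z'; rewrite mem_cat => /orP[z'on|z'off] z'z.
    have : z' \in unzip2 (zip rest (rem z on)).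
      by rewrite unzip2_zip ?srest ?son // mem_rem_uniq // inE z'z.
    case/mapP => -[r o] ro /= z'o; apply: (@chords_eq0 _ (r, o)).
      by rewrite inE ro orbT.
    by rewrite z'o eqxx orbT.
  have [z'u|z'u] := eqVneq z' u.
    by apply: (@chords_eq0 _ (u, v)); rewrite ?mem_head ?z'u ?eqxx.
  have [z'v|z'v] := eqVneq z' v.
    by apply: (@chords_eq0 _ (u, v)); rewrite ?mem_head ?z'v ?eqxx ?orbT.
  have : z' \in unzip1 (zip rest (rem z on)).
    by rewrite unzip1_zip ?srest ?son // mem_rem_uniq ?rem_uniq // inE z'v mem_rem_uniq // inE z'u.
  case/mapP => -[r o] ro /= z'r; apply: (@chords_eq0 _ (r, o)).
    by rewrite inE ro orbT.
  by rewrite z'r eqxx.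
have [z_off zzs] := off_in zoff.
have uus : uniq (rem z off) by rewrite rem_uniq.
have [|||u [v [uo vo vu uvz]]] := chord_avoiding uus zzs _ _ m0.
- by move=> v /mem_rem/off_in[].
- by rewrite mem_rem_uniq // inE eqxx.
- by rewrite size_rem // size_off.
pose rest := rem v (rem u (rem z off)).
have restP r : (r \in rest) = [&& r != v, r != u, r != z & r \in off].
  by rewrite 2?[in LHS]mem_rem_uniq ?rem_uniq // inE [in LHS]mem_rem_uniq ?rem_uniq // inE
    [in LHS]mem_rem_uniq // inE.
have srest : size rest = m.-2.
  by rewrite size_rem ?size_rem ?size_off // mem_rem_uniq // inE vu.
(* A generic second point w makes the line from each remaining r avoid z. *)
have [|w _ wP] := generic_vector (oner_neq0 _ : (1 : {mpoly F[3]}) != 0)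
    (_ : 0 \notin [seq cross z r | r <- rest]).
  apply/mapP => -[r]; rewrite restP => /and4P[_ _ rz /off_in[_ rzs]] /esym/eqP.
  by apply/negP; apply: indep => //; rewrite eq_sym.
pose ps := (u, v) :: [seq (r, w) | r <- rest].
exists (linform p * chords ps); split.
- have := dhomogM (linform_homog p) (chords_homog ps).
  by rewrite /= size_map srest; case: m m1 => [|[|k]].
- rewrite mevalM meval_linform mulf_neq0 // chords_neq0 // => c.
  rewrite inE => /orP[/eqP -> //|/mapP[r rrest -> /=]].
  by rewrite -det3C; apply: wP; apply: map_f.
move=> z'; rewrite mem_cat mevalM meval_linform => /orP[z'on|z'off] z'z.
  by move: z'on; rewrite on_in => /andP[/eqP -> _]; rewrite mul0r.
suff -> : (chords ps).@[z' 0] = 0 by rewrite mulr0.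
have [z'u|z'u] := eqVneq z' u.
  by apply: (@chords_eq0 _ (u, v)); rewrite ?mem_head ?z'u ?eqxx.
have [z'v|z'v] := eqVneq z' v.
  by apply: (@chords_eq0 _ (u, v)); rewrite ?mem_head ?z'v ?eqxx ?orbT.
apply: (@chords_eq0 _ (z', w)); last by rewrite eqxx.
by rewrite inE map_f ?orbT // restP z'v z'u z'z.
Qed.

Lemma dim_vanishing_le (W : {vspace dhomog 3 F m}) :
  (forall f z, f \in W -> z \in zs -> (mpoly_of_dhomog f).@[z 0] = 0) ->
  (\dim W <= 'C(m, 2))%N.
Proof.
move=> Wzs; have uT : uniq (on ++ off).
  rewrite cat_uniq filter_uniq // take_uniq ?filter_uniq // andbT.
  by apply/hasPn => z /off_in[zoff _]; rewrite on_in (negPf zoff).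
have sT : size (on ++ off) = (2 * m).+1.
  by rewrite size_cat size_off size_filter onm addnS mul2n addnn.
suff : (\dim W + size (on ++ off) <= \dim {: dhomog 3 F m})%N.
  by rewrite dim_dhomog3 sT !binS bin1 bin0; lia.
apply: dim_evals_indep => [i lti|f fW]; last first.
  apply/allP => z; rewrite mem_cat => zT; rewrite (Wzs f) //.
  by case/orP: zT => [|/off_in[] //]; rewrite on_in => /andP[].
have [f [fm fi fT]] := separating_curve (mem_nth 0 lti).
exists (DHomog fm) => k ltk /=.
have [->|ki] := eqVneq k i; first exact: negPf.
by rewrite fT ?eqxx ?mem_nth // nth_uniq.
Qed.

End IndependentConditions.

(** * Modular points *)

Section ModularPoints.
Variables (F : fieldType).
Implicit Types (u v w x z p : 'rV[F]_3) (zs : seq 'rV[F]_3).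

Lemma orthogonal_pair u v x : cross u v != 0 -> dot u x = 0 -> dot v x = 0 ->
  exists c, x = c *: cross u v.
Proof.
move=> uv0 ux vx; apply: cross_eq0_colinear => //.
by rewrite crossN double_cross ![dot x _]dotC ux vx !scale0r subr0 oppr0.
Qed.

(** Modularity in dual terms: zs are the lines, v and p points, and v is singular
    when at least two lines pass through it. *)
Definition modular_vec zs p := forall v, v != 0 ->
  (1 < count (on_line v) zs)%N -> cross p v != 0 ->
  exists2 z, z \in zs & on_line p z && on_line v z.

Lemma cross_id u : cross u u = 0.
Proof. by apply/rowP => i; rewrite !mxE; ring. Qed.

Lemma count_pair zs v z z' : z \in zs -> z' \in zs -> z != z' ->
  on_line v z -> on_line v z' -> (1 < count (on_line v) zs)%N.
Proof.
move=> zzs z'zs zz' vz vz'.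
rewrite -size_filter (@uniq_leq_size _ [:: z; z']) //= ?inE ?zz' // => x.
by rewrite !inE mem_filter => /orP[]/eqP ->; rewrite ?vz ?vz'.
Qed.

Lemma meet_point_colinear u v x z : cross u v != 0 -> z != 0 ->
  dot u x = 0 -> dot v x = 0 -> dot u z = 0 -> dot v z = 0 ->
  exists a, x = a *: z.
Proof.
move=> uv0 z0 ux vx uz vz.
have [a ->] := orthogonal_pair uv0 ux vx.
have [c zE] := orthogonal_pair uv0 uz vz.
have c0 : c != 0 by apply: contraNneq z0 => c0; rewrite zE c0 scale0r.
by exists (a / c); rewrite zE scalerA divfK.
Qed.

(** Suppose that a singular point v is not joined to p, a point of maximal
    multiplicity, by a line of zs.  Then v is not the modular point p0, to which p
    is joined.  Let l be a line of zs through v but not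
    through p0; it does not pass through p.  The lines through
    p cut l in distinct singular points, which are joined to p0 by distinct lines
    of zs.  By maximality these are all the lines through p0, so one of them
    contains v, and v is on l and on one of the lines through p. *)
Lemma max_mult_modular zs p0 p :
  uniq zs -> pairwise_indep zs -> p0 != 0 -> p != 0 -> modular_vec zs p0 ->
  (1 < count (on_line p) zs)%N ->
  (forall v, v != 0 -> (count (on_line v) zs <= count (on_line p) zs)%N) ->
  modular_vec zs p.
Proof.
move=> uzs ind p00 p0' mod0 p2 pmax v v0 v2 pv.
apply/hasP; apply: contraT => /hasPn nopv.
have nov z : z \in zs -> dot p z = 0 -> dot v z = 0 -> False.
  by move=> /nopv + pz vz; rewrite /on_line pz vz eqxx.
have p0v : cross p0 v != 0.
  apply/eqP => /(cross_eq0_colinear p00)[a vE].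
  have p0p : cross p0 p != 0.
    apply/eqP => /(cross_eq0_colinear p00)[b pE]; case/eqP: pv.
    by rewrite pE vE; apply/rowP => i; rewrite !mxE; ring.
  have [z zzs /andP[/eqP p0z /eqP pz]] := mod0 p p0' p2 p0p.
  by apply: (nov z zzs pz); rewrite vE dotC dotZr dotC p0z mulr0.
have [l lzs [vl p0l]] : exists2 l, l \in zs & dot v l = 0 /\ dot p0 l != 0.
  have [z1 [z2 [z1z z2z z12 vz1 vz2]]] : exists z1 z2,
      [/\ z1 \in zs, z2 \in zs, z1 != z2, dot v z1 = 0 & dot v z2 = 0].
    move: v2; rewrite -size_filter.
    case E : [seq z <- zs | on_line v z] => [|z1 [|z2 s]] // _.
    have mE z : (z \in z1 :: z2 :: s) = on_line v z && (z \in zs).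
      by rewrite -E mem_filter.
    have := mE z1; have := mE z2; rewrite !inE !eqxx orbT /=.
    move=> /esym/andP[/eqP v2 z2zs] /esym/andP[/eqP v1 z1zs]; exists z1, z2; split=> //.
    have : uniq (z1 :: z2 :: s) by rewrite -E filter_uniq.
    by rewrite /= inE negb_or => /andP[/andP[]].
  have [p1|] := eqVneq (dot p0 z1) 0; last by exists z1.
  have [p2'|] := eqVneq (dot p0 z2) 0; last by exists z2.
  have z10 : z1 != 0.
    apply: contraNneq (ind _ _ z1z z2z z12) => ->.
    by apply/eqP/rowP => i; rewrite !mxE !mul0r subrr.
  have [a z2E] := meet_point_colinear p0v z10 p2' vz2 p1 vz1.
  case/eqP: (ind _ _ z1z z2z z12); rewrite z2E.
  by apply/rowP => i; rewrite !mxE; ring.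
have pl : dot p l != 0 by apply/eqP => pl; exact: (nov l).
pose K := [seq k <- zs | on_line p k].
pose N := [seq n <- zs | on_line p0 n].
have K_in k : (k \in K) = on_line p k && (k \in zs) by rewrite mem_filter.
have lk k : k \in K -> cross l k != 0.
  rewrite K_in => /andP[/eqP pk kzs]; apply: ind => //.
  by apply: contraNneq pl => ->; rewrite pk.
pose joins k := fun n => on_line p0 n && on_line (cross l k) n.
have has_join k : k \in K -> has (joins k) zs.
  move=> kK; apply/hasP; have lk0 := lk k kK.
  move: kK; rewrite K_in => /andP[/eqP pk kzs].
  apply: (mod0 _ lk0).
    apply: (@count_pair _ _ l k) => //; first by apply: contraNneq pl => ->; rewrite pk.
      by rewrite /on_line dotC dot_crossl.
    by rewrite /on_line dotC dot_crossr.
  apply/eqP => /(cross_eq0_colinear p00)[a xE].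
  have := dot_crossl l k; rewrite xE dotZr => /eqP.
  rewrite mulf_eq0 dotC (negPf p0l) orbF => /eqP a0.
  by rewrite xE a0 scale0r eqxx in lk0.
(* The line joining p0 to the intersection of l and k; the default value 0 is
   never used for k in K. *)
pose join k := nth 0 zs (find (joins k) zs).
have joinP k : k \in K ->
    [/\ join k \in zs, dot p0 (join k) = 0, dot (join k) (cross l k) = 0 &
        cross (join k) l != 0].
  move=> /has_join hk; have /andP[/eqP jp0 /eqP jx] := nth_find 0 hk.
  have jzs : join k \in zs by rewrite mem_nth -?has_find.
  split; rewrite // 1?dotC //; apply: ind => //.
  by apply: contraNneq p0l => <-; rewrite jp0.
have join_eq k w : k \in K -> w != 0 -> dot l w = 0 -> dot (join k) w = 0 ->
    dot k w = 0.
  move=> kK w0 lw jw; have [jzs jp0 jx jl] := joinP k kK.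
  have [a ->] := meet_point_colinear jl (lk k kK) jw lw jx (dot_crossl l k).
  by rewrite dotZr dot_crossr mulr0.
have inj_join : {in K &, injective join}.
  move=> k k' kK k'K e; have [_ _ jx' _] := joinP k' k'K.
  have kx : dot k (cross l k') = 0.
    by apply: join_eq; rewrite ?lk ?dot_crossl // e.
  move: (kK) (k'K); rewrite !K_in => /andP[/eqP pk kzs] /andP[/eqP pk' k'zs].
  apply: contraNeq pl => /(ind _ _ kzs k'zs) kk'.
  have [||a pE] := meet_point_colinear kk' (lk k' k'K) _ _ kx (dot_crossr l k') (x := p).
  - by rewrite dotC.
  - by rewrite dotC.
  by rewrite pE dotC dotZr dot_crossl mulr0.
have [|||_ imN] := @uniq_min_size _ (map join K) N.
- by rewrite map_inj_in_uniq ?filter_uniq.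
- move=> _ /mapP[k kK ->]; have [jzs jp0 _ _] := joinP k kK.
  by rewrite mem_filter /on_line jp0 eqxx.
- by rewrite size_map !size_filter pmax.
have [n nzs /andP[n0 nv]] := mod0 v v0 v2 p0v.
have : n \in map join K by rewrite imN mem_filter n0.
case/mapP => k kK nE; move: (kK); rewrite K_in => /andP[/eqP pk kzs].
case: (nov k kzs pk); rewrite dotC; apply: join_eq; rewrite // ?(dotC l) //.
by rewrite -nE dotC; apply/eqP.
Qed.

Lemma modular_collinear zs p z z' : pairwise_indep zs -> modular_vec zs p ->
  z \in zs -> z' \in zs -> z != z' -> ~~ on_line p z ->
  exists2 z'', z'' \in zs & on_line p z'' /\ det3 z z' z'' = 0.
Proof.
move=> ind mod zzs z'zs zz' pz; have v0 := ind z z' zzs z'zs zz'.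
have [||z2 z2zs /andP[pz2 /eqP vz2]] := mod _ v0.
- apply: (@count_pair _ _ z z') => //.
    by rewrite /on_line dotC dot_crossl.
  by rewrite /on_line dotC dot_crossr.
- apply/eqP => c0; have p0 : p != 0.
    by apply: contraNneq pz => ->; rewrite /on_line dotC dot0r.
  have [a vE] := cross_eq0_colinear p0 c0.
  have := dot_crossl z z'; rewrite vE dotZr => /eqP.
  rewrite mulf_eq0 dotC -[dot p z == 0]/(on_line p z) (negPf pz) orbF => /eqP a0.
  by rewrite vE a0 scale0r eqxx in v0.
by exists z2.
Qed.

End ModularPoints.

(** * Arrangements and their dual configurations *)

Section DualVectors.
Variable F : fieldType.
Implicit Types (l : line F) (P Q : point F) (v : 'rV[F]_3) (A : {fset line F}).

Lemma dim1_vpick (U : {vspace 'rV[F]_3}) : \dim U == 1%N ->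
  U = <[vpick U]>%VS /\ vpick U != 0.
Proof.
move=> dU; have U0 : vpick U != 0.
  by rewrite vpick0; apply: contraTneq dU => ->; rewrite dimv0.
split=> //; apply/eqP; rewrite eq_sym eqEdim dim_vline U0 (eqP dU) andbT.
by rewrite -memvE memv_pick.
Qed.

Lemma point_vec P : exists2 v, v != 0 & point_space P = <[v]>%VS.
Proof. by have [e v0] := dim1_vpick (point_dim P); exists (vpick P). Qed.

Lemma vec_point v : v != 0 -> exists P, point_space P = <[v]>%VS.
Proof.
move=> v0; have dv : \dim <[v]> == 1%N by rewrite dim_vline v0.
by exists (Point dv).
Qed.

(** A vector spanning the dual point of l. *)
Definition normal l : 'rV[F]_3 := vpick (orth l).

Lemma dual_pointE l : point_space (dual_point l) = <[normal l]>%VS.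
Proof. by have [] := dim1_vpick (dual_point_subproof l). Qed.

Lemma normal_neq0 l : normal l != 0.
Proof. by have [] := dim1_vpick (dual_point_subproof l). Qed.

Lemma mem_line l v : (v \in line_space l) = (dot (normal l) v == 0).
Proof.
apply/idP/eqP => [/dual_pointP|nv].
  by apply; rewrite dual_pointE memv_line.
apply/dual_pointP => x; rewrite dual_pointE => /vlineP[a ->].
by rewrite -/(dot (a *: normal l) v) dotC dotZr dotC nv mulr0.
Qed.

Lemma normal_cross l l' : l != l' -> cross (normal l) (normal l') != 0.
Proof.
apply: contra_neq => /(cross_eq0_colinear (normal_neq0 l))[a nE].
have a0 : a != 0 by apply: contraNneq (normal_neq0 l') => a0; rewrite nE a0 scale0r.
apply/val_inj/vspaceP => v; rewrite /= !mem_line nE.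
by rewrite [dot (_ *: _) _]dotC dotZr mulf_eq0 (negPf a0) dotC.
Qed.

Definition normals A : seq 'rV[F]_3 := [seq normal l | l <- enum_fset A].

Lemma normals_indep A : pairwise_indep (normals A).
Proof.
move=> _ _ /mapP[l _ ->] /mapP[l' _ ->] ne.
by apply: normal_cross; apply: contraNneq ne => ->.
Qed.

Lemma normals_uniq A : uniq (normals A).
Proof.
rewrite map_inj_uniq ?fset_uniq // => l l' e; apply: contra_eq e => /normal_cross.
by apply: contraNneq => ->; rewrite cross_id.
Qed.

Lemma size_normals A : size (normals A) = #|` A|.
Proof. by rewrite size_map. Qed.

Lemma incident_vec P v l : point_space P = <[v]>%VS ->
  incident P l = on_line v (normal l).
Proof. by move=> Pv; rewrite /incident Pv -memvE mem_line /on_line dotC. Qed.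

Lemma mult_count A P v : point_space P = <[v]>%VS ->
  mult A P = count (on_line v) (normals A).
Proof.
move=> Pv; rewrite /mult count_map -size_filter.
apply/perm_size/uniq_perm; rewrite ?filter_uniq ?fset_uniq // => l.
by rewrite mem_filter /= !inE andbC -(incident_vec _ Pv).
Qed.

Lemma modular_point_vec A P v : point_space P = <[v]>%VS -> v != 0 ->
  modular_point A P -> modular_vec (normals A) v.
Proof.
move=> Pv v0 mod u u0; have [Q Qu] := vec_point u0.
rewrite -(mult_count A Qu) => Qsing vu.
have [|l lA lE] := mod Q Qsing.
  apply: contraNneq vu => QP; have : u \in <[v]>%VS by rewrite -Pv -QP Qu memv_line.
  by case/vlineP => a ->; apply/eqP/rowP => i; rewrite !mxE; ring.
exists (normal l); first exact: map_f.
rewrite -(incident_vec _ Pv) -(incident_vec _ Qu) /incident lE.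
by rewrite addvSl addvSr.
Qed.

Lemma vanishing_dual A f z : vanishing_ideal (dual_config A) f ->
  z \in normals A -> f.@[z 0] = 0.
Proof.
move=> fA /mapP[l lA ->]; apply: (fA (dual_point l)); first exact: in_imfset.
by rewrite dual_pointE memv_line.
Qed.

Lemma vanishing_dual_homog A f d : f \is d.-homog ->
  (forall z, z \in normals A -> f.@[z 0] = 0) -> vanishing_ideal (dual_config A) f.
Proof.
move=> fd fz P /imfsetP[l /= lA ->] v; rewrite dual_pointE => /vlineP[a ->].
by rewrite (meval_homogZ _ _ fd) fz ?mulr0 // map_f.
Qed.

End DualVectors.

(** * Unexpected curves of the dual configuration *)

Section GeneralPoints.
Variable F : numFieldType.
Implicit Types (p q v z : 'rV[F]_3) (zs : seq 'rV[F]_3) (H : point F -> Prop).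

(** The line p and the lines through two points of zs. *)
Definition special_lines zs p : seq 'rV[F]_3 :=
  p :: [seq cross c.1 c.2 | c <- [seq (z, z') | z <- zs, z' <- zs] & c.1 != c.2].

Lemma special_linesP zs p q :
  (forall u, u \in special_lines zs p -> dot u q != 0) <->
  dot p q != 0 /\ general_for zs q.
Proof.
split=> [qP|[pq qgen] u].
  split=> [|z z' zzs z'zs zz']; first by rewrite qP ?mem_head.
  rewrite det3C; apply: qP; rewrite inE; apply/orP; right.
  by apply: (map_f (fun c => cross c.1 c.2) (x := (z, z'))); rewrite mem_filter zz' allpairs_f.
rewrite inE => /orP[/eqP -> //|/mapP[c]].
rewrite mem_filter => /andP[cc' /allpairsP[[z z'] /= [zzs z'zs cE]]] ->.
by move: cc'; rewrite cE /= -/(det3 z z' q) -det3C; apply: qgen.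
Qed.

Lemma special_lines_neq0 zs p : pairwise_indep zs -> p != 0 ->
  0 \notin special_lines zs p.
Proof.
move=> ind p0; rewrite inE negb_or eq_sym p0; apply/mapP => -[c].
rewrite mem_filter => /andP[cc' /allpairsP[[z z'] /= [zzs z'zs cE]]] /esym/eqP.
by apply/negP; move: cc'; rewrite cE; apply: ind.
Qed.

(** The points off the special lines are the complement of the zero set of a
    product of linear forms. *)
Lemma general_intro zs p H : pairwise_indep zs -> p != 0 ->
  (forall Q q, point_space Q = <[q]>%VS -> dot p q != 0 -> general_for zs q -> H Q) ->
  general H.
Proof.
move=> ind p0 HP; have sl0 := special_lines_neq0 ind p0.
pose N : {mpoly F[3]} := \prod_(u <- special_lines zs p) linform u.
have NE v : N.@[v 0] = \prod_(u <- special_lines zs p) dot u v.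
  by rewrite /N rmorph_prod; apply: eq_bigr => u _; exact: meval_linform.
have Nhom : N \is (size (special_lines zs p)).-homog.
  rewrite /N; elim: (special_lines zs p) => [|u s IH]; first by rewrite big_nil dhomog1.
  by rewrite big_cons; exact: dhomogM (linform_homog _) IH.
exists (fun P => forall f, f = N -> vanishes_at f P); split.
- by exists (fun f => f = N); split=> // f ->; exists (size (special_lines zs p)).
- have [v _ vP] := generic_vector (oner_neq0 _ : (1 : {mpoly F[3]}) != 0) sl0.
  have v0 : v != 0.
    by apply: contraNneq (vP p (mem_head _ _)) => ->; rewrite dot0r.
  have [P Pv] := vec_point v0.
  move/(congr1 (@^~ P)) => /= PN.
  have : forall f, f = N -> vanishes_at f P by rewrite PN.
  move=> /(_ N erefl v); rewrite Pv memv_line NE => /(_ isT)/eqP.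
  by apply/negP; rewrite prodf_seq_neq0; apply/allP.
move=> Q /= QN; have [q q0 Qq] := point_vec Q.
have [] // : dot p q != 0 /\ general_for zs q; last by move=> *; apply: (HP Q q).
apply/special_linesP => u us; apply: contra_notN QN => /eqP uq f -> v.
rewrite Qq => /vlineP[a ->]; rewrite (meval_homogZ _ _ Nhom) NE (big_rem u) //= uq.
by rewrite mul0r mulr0.
Qed.

(** Two nonempty open sets meet. *)
Lemma general_elim zs p H : pairwise_indep zs -> p != 0 -> general H ->
  exists Q q, [/\ point_space Q = <[q]>%VS, dot p q != 0, general_for zs q & H Q].
Proof.
move=> ind p0 [V [[S [Shom VE]] VT VH]].
have [P nVP] : exists P, ~ V P.
  apply: contrapT => noP; apply: VT; rewrite predeqE => P; split=> // _.
  by apply: contrapT => nVP; apply: noP; exists P.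
have [f Sf [w wP fw]] : exists2 f, S f & exists2 w, w \in point_space P & f.@[w 0] != 0.
  apply: contrapT => nof; apply: nVP; rewrite VE => f Sf w wP.
  by apply/eqP; apply: contrapT => /negP fw; apply: nof; exists f => //; exists w.
have f0 : f != 0 by apply: contraNneq fw => ->; rewrite meval0.
have [q fq qP] := generic_vector f0 (special_lines_neq0 ind p0).
have [pq qgen] := (special_linesP zs p q).1 qP.
have q0 : q != 0 by apply: contraNneq pq => ->; rewrite dot0r.
have [Q Qq] := vec_point q0; exists Q, q; split=> //.
apply: VH => /=; rewrite VE => /(_ f Sf q); rewrite Qq memv_line => /(_ isT)/eqP.
exact/negP.
Qed.

Lemma general_exists zs p : pairwise_indep zs -> p != 0 ->
  exists Q q, [/\ point_space Q = <[q]>%VS, dot p q != 0 & general_for zs q].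
Proof.
move=> ind p0; have [|Q [q [Qq pq qgen _]]] := @general_elim zs p (fun=> True) ind p0.
  exact: (general_intro ind p0).
by exists Q, q.
Qed.

End GeneralPoints.

Section DualConfiguration.
Variables (F : numFieldType) (A : {fset line F}) (p : 'rV[F]_3) (m : nat).
Hypotheses (m1 : (1 < m)%N) (onm : count (on_line p) (normals A) = m).

Let Z := dual_config A.
Let zs := normals A.
Let d := #|` A|.

Let uzs : uniq zs. Proof. exact: normals_uniq. Qed.
Let ind : pairwise_indep zs. Proof. exact: normals_indep. Qed.
Let offm : count (predC (on_line p)) zs = (d - m)%N.
Proof. by have := count_predC (on_line p) zs; rewrite size_normals onm; lia. Qed.
Let le_md : (m <= d)%N.
Proof. by rewrite -onm /d -size_normals count_size. Qed.
Let size_gt1 : (1 < size zs)%N.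
Proof. by rewrite size_normals (leq_trans m1). Qed.

(** The excesses j + 2 - m and j + 1 - (d - m) are the numbers of additional zeros
    that fat_curve_eq0 needs. *)
Lemma fat_dim_le Q q j : point_space Q = <[q]>%VS ->
  dot p q != 0 -> general_for zs q ->
  (\dim (graded_part (fat_ideal Z j Q) j.+1) <= (j.+2 - m) + (j.+1 - (d - m)))%N.
Proof.
move=> Qq pq qgen; have [e1 [e2 [s [x [y fr]]]]] := frame_exists uzs size_gt1 pq qgen.
have [ts [sts uts fresh]] :=
  fresh_seq (map (slope x y) zs) ((j.+2 - m) + (j.+1 - (d - m))).
pose xs := take (j.+2 - m) ts; pose ys := drop (j.+2 - m) ts.
have sxs : size xs = (j.+2 - m)%N by rewrite size_take_min sts; lia.
have sys : size ys = (j.+1 - (d - m))%N by rewrite size_drop sts; lia.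
have := @dim_le_evals F j.+1 ([seq e1 + t *: e2 | t <- xs] ++ [seq q + e1 + t *: e2 | t <- ys])
  (graded_part (fat_ideal Z j Q) j.+1) 0%VS.
rewrite size_cat !size_map sxs sys dimv0 addn0; apply => f.
move=> /(graded_partP (fat_ideal_subspace Z j Q))[fZ fQ].
rewrite all_cat => /andP[/allP fxs /allP fys]; rewrite memv0.
apply/eqP/val_inj/(@fat_curve_eq0 F zs p q e1 e2 s x y pq qgen fr Q j xs ys) => //.
- by rewrite Qq memv_line.
- exact: dhomog_is_dhomog.
- by move=> z zzs; apply: vanishing_dual fZ zzs.
- by move=> t txs; apply/eqP/fxs/map_f.
- by move=> t tys; apply/eqP/fys; apply/mapP; exists t.
- exact: take_uniq.
- exact: drop_uniq.
- by move=> t; rewrite cat_take_drop; apply: fresh.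
- by rewrite sxs onm; lia.
by rewrite sys offm; lia.
Qed.

Hypothesis p0 : p != 0.

(** A form of degree t vanishing at t + 1 points of a line vanishes on that line,
    so the m points on p impose at most t + 1 conditions. *)
Lemma vanishing_dim_ge t :
  ('C(t.+2, 2) <= minn m t.+1 + (d - m)
                  + \dim (graded_part (vanishing_ideal Z) t))%N.
Proof.
have [Q [q [Qq pq qgen]]] := general_exists ind p0.
have [e1 [e2 [s [x [y fr]]]]] := frame_exists uzs size_gt1 pq qgen.
pose on := [seq z <- zs | on_line p z]; pose off := [seq z <- zs | ~~ on_line p z].
have son : size on = m by rewrite size_filter.
have := @dim_le_evals F t (take t.+1 on ++ off) fullv (graded_part (vanishing_ideal Z) t).
rewrite dim_dhomog3 size_cat size_take_min son size_filter offm minnC; apply => f _.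
rewrite all_cat => /andP[/allP f_on /allP f_off].
apply/(graded_partP (vanishing_ideal_subspace Z)).
have ft : mpoly_of_dhomog f \is t.-homog by apply: dhomog_is_dhomog.
apply: (vanishing_dual_homog ft) => z zzs.
have [zon|zoff] := boolP (on_line p z); last first.
  by apply/eqP/f_off; rewrite mem_filter zoff.
have on_dec v : v \in on -> dot x v != 0 /\ v = dot x v *: (e1 + slope x y v *: e2).
  rewrite mem_filter /on_line -(frame_s_eq0 pq fr) => /andP[/eqP sv vzs].
  have xv := frame_x fr vzs; split=> //.
  by rewrite {1}(slope_dec fr xv) sv mul0r scale0r add0r.
have z_on : z \in on by rewrite mem_filter zon.
have [small|big] := leqP (size on) t.+1.
  by apply/eqP/f_on; rewrite take_oversize.
suff h0 : line_restr e1 e2 (mpoly_of_dhomog f) = 0.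
  have [_ ->] := on_dec z z_on.
  by rewrite (meval_homogZ _ _ ft) -horner_line_restr h0 horner0 mulr0.
have [sh _] := line_restr_homog e1 e2 ft.
apply: contraTeq sh => h0; rewrite -ltnNge.
have := @max_poly_roots _ _ (map (slope x y) (take t.+1 on)) h0.
rewrite size_map size_takel ?(ltnW big) //; apply.
  apply/allP => _ /mapP[v von ->]; have [xv vE] := on_dec v (mem_take von).
  have := f_on v von; rewrite {1}vE (meval_homogZ _ _ ft) mulf_eq0 expf_eq0 (negPf xv) andbF.
  by rewrite rootE horner_line_restr.
rewrite map_inj_in_uniq ?take_uniq ?filter_uniq // => v v' /mem_take von /mem_take v'on.
by apply: (slope_inj qgen fr); [move: von|move: v'on]; rewrite mem_filter => /andP[].
Qed.

(** The upper bound of fat_dim_le does not exceed the expected dimension, except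
    when m - 2 < j < d - m - 1; for d = 2m + 1 this leaves the degree m only. *)
Lemma not_unexpected t : (d <= 2 * m + 1)%N -> (d = 2 * m + 1 -> t <> m)%N ->
  ~ unexpected_in_degree Z t.
Proof.
move=> dm tm [j tE /(general_elim ind p0)[Q [q [Qq pq qgen]]]] /=.
have fat_le := fat_dim_le j Qq pq qgen; have van_ge := vanishing_dim_ge j.+1.
have binE : 'C(j.+3, 2) = ('C(j.+1, 2) + (2 * j + 3))%N.
  by rewrite binS bin1 [in LHS]binS bin1; lia.
have := le_md; move: dm tm fat_le van_ge; rewrite tE binE.
set D := \dim _; set B := \dim _; set C := 'C(_, _); set e := d.
move: D B C e => D B C e; lia.
Qed.

Hypothesis max_m : forall v, v != 0 -> (count (on_line v) zs <= m)%N.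
Hypothesis modular : modular_vec zs p.

Lemma fat_dim_gt0 Q q : point_space Q = <[q]>%VS ->
  dot p q != 0 -> general_for zs q ->
  (0 < \dim (graded_part (fat_ideal Z m.-1 Q) m))%N.
Proof.
move=> Qq pq qgen; have [e1 [e2 [s [x [y fr]]]]] := frame_exists uzs size_gt1 pq qgen.
have mE : m = m.-1.+1 by rewrite prednK // ltnW.
have [||f [f0 fm fQ fz]] := @supersolvable_curve F zs p q e1 e2 s x y pq fr Q m.-1 Qq uzs ind.
- by rewrite -mE.
- by move=> z z' zzs z'zs zz' pz _; apply: modular_collinear.
rewrite -mE in fm.
rewrite lt0n dimv_eq0; apply: contraNneq f0 => V0.
have : DHomog fm \in graded_part (fat_ideal Z m.-1 Q) m.
  apply/(graded_partP (fat_ideal_subspace _ _ _)); split=> //=.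
  exact: (vanishing_dual_homog fm).
by rewrite V0 memv0 => /eqP/(congr1 (@mpoly_of_dhomog _ _ _)) /= ->.
Qed.

Lemma unexpected_degree_m : (2 * m < d)%N -> unexpected_in_degree Z m.
Proof.
move=> dm; exists m.-1; first by rewrite prednK // ltnW.
rewrite prednK ?(ltnW m1) //; apply: (general_intro ind p0) => Q q Qq pq qgen /=.
apply: leq_ltn_trans (fat_dim_gt0 Qq pq qgen); rewrite leqn0 subn_eq0.
apply: (@dim_vanishing_le F zs p m uzs ind max_m m1 onm); first by rewrite size_normals.
move=> f z /(graded_partP (vanishing_ideal_subspace Z)) fZ zzs.
exact: vanishing_dual fZ zzs.
Qed.

End DualConfiguration.

(** A point through which at most one line passes satisfies the bound m because
    m > 1. *)
Lemma max_mult_point (F : numFieldType) (A : {fset line F}) m :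
  supersolvable A -> is_max_mult A m ->
  exists p, [/\ p != 0, (1 < m)%N, count (on_line p) (normals A) = m,
    forall v, v != 0 -> (count (on_line v) (normals A) <= m)%N &
    modular_vec (normals A) p].
Proof.
move=> [P0 mod0] [[P Psing Pm] Pmax].
have [p p0 Pp] := point_vec P; have [u u0 P0u] := point_vec P0.
have m1 : (1 < m)%N by rewrite -Pm.
have onm : count (on_line p) (normals A) = m by rewrite -(mult_count A Pp).
have max_m v : v != 0 -> (count (on_line v) (normals A) <= m)%N.
  move=> v0; have [Q Qv] := vec_point v0; rewrite -(mult_count A Qv).
  by have [/Pmax//|small] := leqP 2 (mult A Q); rewrite (leq_trans _ m1) // ltnW.
have mod0u := modular_point_vec P0u u0 mod0.
have p2 : (1 < count (on_line p) (normals A))%N by rewrite onm.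
have pmax v : v != 0 ->
    (count (on_line v) (normals A) <= count (on_line p) (normals A))%N.
  by rewrite onm; apply: max_m.
exists p; split=> //.
exact: (max_mult_modular (normals_uniq A) (@normals_indep _ A)) mod0u p2 pmax.
Qed.

Lemma supersolvable_unexpected (F : numFieldType) (A : {fset line F}) (m : nat) :
  supersolvable A -> is_max_mult A m ->
  (arrangement_admits_unexpected A <-> (2 * m < #|` A|)%N) /\
  (#|` A| = (2 * m + 1)%N -> unique_unexpected_curve (dual_config A) m).
Proof.
move=> hA hm; have [p [p0 m1 onm max_m modular]] := max_mult_point hA hm.
have degree_m := unexpected_degree_m m1 onm p0 max_m modular.
split=> [|dE].
  split=> [[t ut]|/degree_m]; last by exists m.
  rewrite ltnNge; apply/negP => dm.
  by apply: (@not_unexpected _ A p m m1 onm p0 t) ut; lia.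
split=> [t|].
  split=> [ut|->]; last by apply: degree_m; lia.
  have [//|/eqP tm] := eqVneq t m.
  by exfalso; apply: (@not_unexpected _ A p m m1 onm p0 t) ut; lia.
apply: (general_intro (@normals_indep _ A) p0) => Q q Qq pq qgen /=.
apply/eqP; rewrite eqn_leq (fat_dim_gt0 m1 onm modular Qq pq qgen) andbT.
have := fat_dim_le m1 onm m.-1 Qq pq qgen.
by rewrite prednK ?(ltnW m1) // dE; lia.
Qed.

Theorem theorem3p7 (R : realType) (A : {fset line R[i]}) (m : nat)
    (hA : supersolvable A) (hm : is_max_mult A m) :
  (arrangement_admits_unexpected A <-> (2 * m < #|` A|)%N) /\
  (#|` A| = (2 * m + 1)%N -> unique_unexpected_curve (dual_config A) m).
Proof. exact: supersolvable_unexpected. Qed.
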